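(* Let $Q$ be a quiver with vertex set $I$, let $A$ be the $\mathbb{C}[\mathrm{h}]$-algebra of heighted links defined in the context, let $\mathbf{d}=(d_i)_{i\in I}\in\mathbb{Z}_{\ge0}^I$, and let $\mathrm{Diff}(\mathrm{Rep}_{\mathbf{d}}(Q))$ be the algebra of polynomial differential operators on the space of representations of $Q$ of dimension vector $\mathbf d$. For a heighted link $X$ with components $(a_{i,1},h_{i,1})\cdots(a_{i,l_i},h_{i,l_i})$, $1\le i\le k$, and vertices $v_1,\dots,v_m$, normalized so that $\{h_{i,j}\}=\{1,2,\dots,N\}$, let $\phi$ be the bijection from the set of index pairs $(i,j)$ onto $\{1,\dots,N\}$ given by $\phi(i,j)=h_{i,j}$, and set $$\rho_{\mathbf d}(X)=d_{v_1}\cdots d_{v_m}\sum_{\substack{(k_{i,j})\\ 1\le k_{i,j}\le d_{(a_{i,j})_s}\ \forall i,j}}\ \prod_{h=1}^{N}[a_{\phi^{-1}(h)}]_{k_{\phi^{-1}(h)},\,k_{\phi^{-1}(h)+1}},$$ where the (noncommutative) product is taken in order of increasing $h$ from left to right and $(i,j)+1=(i,j+1)$ with second index modulo $l_i$. Then $\rho_{\mathbf d}$, with $\mathrm{h}\mapsto1$, is well defined on $A$ and gives a homomorphism of $\mathbb{C}$-algebras $\rho_{\mathbf d}:A\to\mathrm{Diff}(\mathrm{Rep}_{\mathbf d}(Q))$.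
   Context: $Q$ is a quiver with vertex set $I$ (loops and multiple edges allowed); $Q$ also denotes its set of edges. Each edge $e$ has source $e_s$ and target $e_t$. The double quiver $\overline{Q}$ has vertex set $I$ and edges $\{e,e^*\mid e\in Q\}$ with $e^*_s=e_t$, $e^*_t=e_s$; put $(e^* )^*=e$. For $f,g\in\overline{Q}$ let $[e,e^*]=1$, $[e^*,e]=-1$ for $e\in Q$, and $[f,g]=0$ if $f\neq g^*$. $\mathrm{h}$ is a formal parameter. **Representations.** $\mathrm{Rep}_{\mathbf d}(Q)$ is the vector space of collections of linear maps $M(e):\mathbb{C}^{d_{e_s}}\to\mathbb{C}^{d_{e_t}}$, $e\in Q$. For $e\in Q$, $1\le p\le d_{e_s}$, $1\le r\le d_{e_t}$, $[e]_{p,r}$ denotes the coordinate function giving the entry of $M(e)$ with source index $p$ and target index $r$. For $e\in Q$, $1\le p\le d_{e_t}$, $1\le r\le d_{e_s}$, put $[e^*]_{p,r}:=-\dfrac{\partial}{\partial[e]_{r,p}}$. $\mathrm{Diff}(\mathrm{Rep}_{\mathbf d}(Q))$ is the algebra generated over $\mathbb{C}$ by all these coordinate functions (acting by multiplication) and the partial derivatives with respect to them. **Heighted links.** A heighted link is a formal expression $$X=(a_{1,1},h_{1,1})\cdots(a_{1,l_1},h_{1,l_1})\,\&\,\cdots\,\&\,(a_{k,1},h_{k,1})\cdots(a_{k,l_k},h_{k,l_k})\,\&\,v_1\,\&\cdots\&\,v_m$$ with $k,m\ge0$, $l_i\ge1$, where each $a_{i,1}\cdots a_{i,l_i}$ is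 a closed path in $\overline{Q}$ (the target of each arrow is the source of the next, cyclically), the heights $h_{i,j}\in\mathbb{N}$ are pairwise distinct, and $v_1,\dots,v_m\in I$. Each word is taken up to cyclic rotation, the components separated by $\&$ are unordered (symmetric product), and two links that differ by replacing the heights by other heights in the same relative order are identified. $\tilde A$ is the free $\mathbb{C}[\mathrm{h}]$-module on the heighted links. Second indices $j$ of $(i,j)$ are read modulo $l_i$. A vertex written in front of a possibly empty word means: if the word is empty, it is that vertex idempotent; otherwise it is omitted. **Relations.** Let $X$ be a heighted link and $(i,j)\ne(i',j')$ with $h_{i,j}<h_{i',j'}$ and no height of $X$ strictly between. Let $X'$ be $X$ with the heights $h_{i,j}$ and $h_{i',j'}$ interchanged. If $i\neq i'$, let $X''$ be obtained from $X$ by replacing the components $i$ and $i'$ by the single component $$[a_{i,j},a_{i',j'}]\,(a_{i,j})_t\,(a_{i,j+1},h_{i,j+1})\cdots(a_{i,j-1},h_{i,j-1})(a_{i',j'+1},h_{i',j'+1})\cdots(a_{i',j'-1},h_{i',j'-1}).$$ If $i=i'$, let $X''$ be obtained by replacing component $i$ by the two components $$[a_{i,j},a_{i,j'}]\,(a_{i,j'})_t\,(a_{i,j'+1},h_{i,j'+1})\cdots(a_{i,j-1},h_{i,j-1})\ \&\ (a_{i,j})_t\,(a_{i,j+1},h_{i,j+1})\cdots(a_{i,j'-1},h_{i,j'-1}).$$ (The scalar $[\cdot,\cdot]$ multiplies the whole link.) $\tilde B\subset\tilde A$ is the $\mathbb{C}[\mathrm{h}]$-submodule generated by all $X-X'-X''$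 (case $i\ne i'$) and all $X-X'-\mathrm{h}X''$ (case $i=i'$). Set $A=\tilde A/\tilde B$. **Product.** For links $X,Y$, the product $XY$ is the $\&$-product of $X$ with the link obtained from $Y$ by adding a constant to all its heights so that they all exceed those of $X$. The unit is the empty link. *)

(* Defs.v *)
From HB Require Import structures.
From mathcomp Require Import all_boot all_order all_algebra.
From mathcomp Require Import finmap.
From mathcomp Require Import generic_quotient ring_quotient.
From mathcomp Require Import monalg.
From mathcomp Require Import boolp functions reals.
From mathcomp Require Import complex.

Set Implicit Arguments.
Unset Strict Implicit.
Unset Printing Implicit Defensive.

Import GRing.Theory.
Local Open Scope ring_scope.
Local Open Scope quotient_scope.

Record quiver (I : choiceType) := Quiver {
  edge : choiceType;
  src : edge -> I;
  tgt : edge -> I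
}.

Section Links.
Variables (I : choiceType) (Q : quiver I).

(* Edges of the double quiver: [inl e] is e and [inr e] is e^*. *)
Definition dedge : choiceType := (edge Q + edge Q)%type.

Definition dsrc (a : dedge) : I :=
  match a with inl e => src e | inr e => tgt e end.
Definition dtgt (a : dedge) : I :=
  match a with inl e => tgt e | inr e => src e end.

Definition bracket (S : pzRingType) (f g : dedge) : S :=
  match f, g with
  | inl e, inr e' => (e == e')%:R
  | inr e', inl e => - (e == e')%:R
  | _, _ => 0
  end.

(* The written expression of a link: its list of words in (arrow, height),
   and its list of vertices. *)
Definition prelink : choiceType := (seq (seq (dedge * nat)) * seq I)%type.

Definition heights (X : prelink) : seq nat := map snd (flatten X.1).

Definition closed_word (w : seq (dedge * nat)) : bool :=
  (w != [::]) && cycle (fun x y => dtgt x.1 == dsrc y.1) w.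

Definition wf_link (X : prelink) : bool :=
  all closed_word X.1 && uniq (heights X).

Definition map_heights (f : nat -> nat) (X : prelink) : prelink :=
  (map (map (fun x => (x.1, f x.2))) X.1, X.2).

(* Cyclic rotation of words, reordering of components, and change of heights
   preserving their relative order. *)
Inductive same_link : prelink -> prelink -> Prop :=
| same_refl X : same_link X X
| same_sym X Y : same_link X Y -> same_link Y X
| same_trans X Y Z : same_link X Y -> same_link Y Z -> same_link X Z
| same_rot ws1 u w ws2 vs :
    same_link (ws1 ++ (u ++ w) :: ws2, vs) (ws1 ++ (w ++ u) :: ws2, vs)
| same_perm ws ws' vs vs' : perm_eq ws ws' -> perm_eq vs vs' ->
    same_link (ws, vs) (ws', vs')
| same_heights f X :
    {in heights X &, {mono f : x y / (x < y)%N}} ->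
    same_link X (map_heights f X).

Record linkrep := LinkRep { rep_val :> prelink; rep_wf : wf_link rep_val }.
HB.instance Definition _ := [isSub for rep_val].
HB.instance Definition _ := [Choice of linkrep by <:].

Definition same_rep (X Y : linkrep) : bool := `[< same_link X Y >].

Lemma same_rep_equiv : equiv_class_of same_rep.
Proof.
split=> [X|X Y|Y X Z]; first by apply/asboolP; exact: same_refl.
- by apply/asboolP/asboolP; exact: same_sym.
- move=> /asboolP XY /asboolP YZ; apply/asboolP; exact: same_trans XY YZ.
Qed.

Canonical same_rep_equivrel := EquivRelPack same_rep_equiv.

Definition link := {eq_quot same_rep}.
HB.instance Definition _ := EqQuotient.on link.
HB.instance Definition _ := Choice.on link.

Lemma same_linkP (X Y : linkrep) :
  reflect (same_link X Y) (X == Y %[mod link]).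
Proof. by rewrite piE; exact: asboolP. Qed.

(* The least constant exceeding all heights. *)
Definition height_bound (X : prelink) : nat := \max_(h <- heights X) h.+1.

Definition prelink_mul (X Y : prelink) : prelink :=
  (X.1 ++ (map_heights (addn^~ (height_bound X)) Y).1, X.2 ++ Y.2).

Lemma heights_map f X : heights (map_heights f X) = map f (heights X).
Proof.
by case: X => ws vs; rewrite /heights /= -map_flatten -!map_comp.
Qed.

Lemma heights_mul X Y : heights (prelink_mul X Y)
  = heights X ++ map (addn^~ (height_bound X)) (heights Y).
Proof.
by rewrite -heights_map /heights /prelink_mul /= flatten_cat map_cat.
Qed.

Lemma height_boundP X h : h \in heights X -> (h < height_bound X)%N.
Proof.
move=> hX; rewrite /height_bound.
by apply: (@leq_bigmax_seq _ _ _ (fun h => h.+1)).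
Qed.

Lemma height_bound_mul X Y :
  height_bound (prelink_mul X Y) = (height_bound X + height_bound Y)%N.
Proof.
rewrite {1}/height_bound heights_mul big_cat /= big_map -/(height_bound X).
move: (height_bound X) => b; rewrite /height_bound; elim: (heights Y) => [|h s IH].
  by rewrite !big_nil addn0 maxn0.
by rewrite !big_cons maxnCA IH addn_maxr addnS [(h + _)%N]addnC.
Qed.

Lemma eq_in_map_heights f g X : {in heights X, f =1 g} ->
  map_heights f X = map_heights g X.
Proof.
case: X => ws vs fg; rewrite /map_heights /=; congr pair.
apply/eq_in_map => w wws; apply/eq_in_map => x xw; congr pair.
apply: fg; apply/mapP; exists x => //; apply/flattenP; by exists w.
Qed.

Lemma closed_word_map f w :
  closed_word (map (fun x => (x.1, f x.2)) w) = closed_word w.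
Proof.
by rewrite /closed_word cycle_map; congr (_ && _); case: w.
Qed.

Lemma wf_mul X Y : wf_link (prelink_mul X Y) = wf_link X && wf_link Y.
Proof.
rewrite /wf_link all_cat heights_mul cat_uniq (map_inj_uniq (@addIn _)).
have -> : all closed_word (map_heights (addn^~ (height_bound X)) Y).1
    = all closed_word Y.1.
  rewrite all_map; apply: eq_all => w.
  exact: (closed_word_map (addn^~ (height_bound X))).
suff -> : has (mem (heights X)) (map (addn^~ (height_bound X)) (heights Y)) = false.
  by rewrite /= andbACA.
apply/negbTE/hasPn => _ /mapP[h _ ->]; apply/negP => /height_boundP.
by rewrite ltnNge leq_addl.
Qed.

Lemma prelink_mulA X Y Z :
  prelink_mul X (prelink_mul Y Z) = prelink_mul (prelink_mul X Y) Z.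
Proof.
case: X Y Z => [xs xv] [ys yv] [zs zv].
rewrite /prelink_mul height_bound_mul /= !map_cat -!catA.
congr (_ ++ (_ ++ _), _).
rewrite -map_comp; apply: eq_map => w /=; rewrite -map_comp.
by apply: eq_map => x /=; rewrite -addnA [(height_bound (xs, xv) + _)%N]addnC.
Qed.

Lemma prelink_mul_congl Y X X' :
  same_link X X' -> same_link (prelink_mul X Y) (prelink_mul X' Y).
Proof.
elim=> {X X'} [X|X X' _|X X' X'' _ XX' _|ws1 u w ws2 vs|ws ws' vs vs' ew ev|f X fm].
- exact: same_refl.
- exact: same_sym.
- exact: same_trans XX'.
- rewrite /prelink_mul; set b := height_bound _; set b' := height_bound _.
  suff -> : b = b' by rewrite /= -!catA; exact: same_rot.
  apply: perm_big; apply: perm_map.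
  by rewrite !flatten_cat /= perm_cat2l perm_cat2r perm_catC.
- rewrite /prelink_mul; set b := height_bound _; set b' := height_bound _.
  suff -> : b = b' by apply: same_perm; rewrite perm_cat2r.
  by apply: perm_big; apply: perm_map; exact: perm_flatten.
pose b := height_bound X; pose b' := height_bound (map_heights f X).
pose g h := if (h < b)%N then f h else (h - b + b')%N.
have -> : prelink_mul (map_heights f X) Y = map_heights g (prelink_mul X Y).
  rewrite {1}/prelink_mul [RHS]/map_heights /= map_cat; congr (_ ++ _, _).
    have /(congr1 fst) : map_heights f X = map_heights g X.
      by apply: eq_in_map_heights => h /height_boundP hb; rewrite /g hb.
    by [].
  rewrite -map_comp; apply: eq_map => w /=; rewrite -map_comp.
  apply: eq_map => x /=; rewrite /g -/b -/b' ltnNge leq_addl /=.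
  by rewrite addnK.
apply: same_heights => h h'.
have fb k : k \in heights X -> (f k < b')%N.
  move=> kX; apply: height_boundP; rewrite heights_map; exact: map_f.
have nb k : (k + b < b)%N = false by rewrite ltnNge leq_addl.
rewrite heights_mul !mem_cat /g -/b.
case/orP => [hX|/mapP[k kY ->]]; case/orP => [h'X|/mapP[k' k'Y ->]].
- by rewrite !height_boundP // fm.
- rewrite (height_boundP hX) nb addnK.
  by rewrite !(leq_trans _ (leq_addl _ _)) // ?fb // height_boundP.
- rewrite nb addnK (height_boundP h'X) !ltnNge.
  by rewrite !(leq_trans (ltnW _) (leq_addl _ _)) // ?fb // height_boundP.
- by rewrite !nb !addnK !ltn_add2r.
Qed.

Lemma prelink_mul_congr X Y Y' :
  same_link Y Y' -> same_link (prelink_mul X Y) (prelink_mul X Y').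
Proof.
elim=> {Y Y'} [Y|Y Y' _|Y Y' Y'' _ YY' _|ws1 u w ws2 vs|ws ws' vs vs' ew ev|f Y fm].
- exact: same_refl.
- exact: same_sym.
- exact: same_trans YY'.
- rewrite /prelink_mul /= !map_cat !map_cons !map_cat !catA; exact: same_rot.
- by apply: same_perm; rewrite perm_cat2l //; exact: perm_map.
pose b := height_bound X.
pose g h := if (h < b)%N then h else (f (h - b) + b)%N.
have -> : prelink_mul X (map_heights f Y) = map_heights g (prelink_mul X Y).
  rewrite {1}/prelink_mul [RHS]/map_heights /= map_cat; congr (_ ++ _, _).
    have /(congr1 fst) : map_heights id X = map_heights g X.
      by apply: eq_in_map_heights => h /height_boundP hb; rewrite /g hb.
    rewrite /= => <-; rewrite -[LHS]map_id; apply: eq_map => w.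
    by rewrite -[LHS]map_id; apply: eq_map => -[].
  rewrite -!map_comp; apply: eq_map => w /=; rewrite -!map_comp.
  apply: eq_map => x /=; rewrite /g -/b ltnNge leq_addl /=.
  by rewrite addnK.
apply: same_heights => h h'.
have nb k : (k + b < b)%N = false by rewrite ltnNge leq_addl.
rewrite heights_mul !mem_cat /g -/b.
case/orP => [hX|/mapP[k kY ->]]; case/orP => [h'X|/mapP[k' k'Y ->]].
- by rewrite !height_boundP.
- rewrite (height_boundP hX) nb addnK.
  by rewrite !(leq_trans _ (leq_addl _ _)) // height_boundP.
- rewrite nb addnK (height_boundP h'X) !ltnNge.
  by rewrite !(leq_trans (ltnW _) (leq_addl _ _)) // height_boundP.
- by rewrite !nb !addnK !ltn_add2r fm.
Qed.

Lemma same_link_wf X Y : same_link X Y -> wf_link X = wf_link Y.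
Proof.
elim=> {X Y} [//|X Y _ ->//|X Y Z _ -> _ ->//|ws1 u w ws2 vs|ws ws' vs vs' ew _|f X fm].
- rewrite /wf_link !all_cat /=; congr (_ && (_ && _) && _).
    rewrite /closed_word -(rot_size_cat u w) rot_cycle; congr (_ && _).
    by rewrite -!size_eq0 size_rot.
  apply: perm_uniq; apply: perm_map.
  by rewrite !flatten_cat /= perm_cat2l perm_cat2r perm_catC.
- rewrite /wf_link /= (perm_all _ ew); congr (_ && _).
  by apply: perm_uniq; apply: perm_map; exact: perm_flatten.
rewrite /wf_link heights_map (@map_inj_in_uniq _ _ f); last first.
  move=> x y xX yX fxy; have := fm x y xX yX; have := fm y x yX xX.
  by rewrite fxy ltnn; case: ltngtP.
congr (_ && _); rewrite all_map; apply: eq_all => w.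
by rewrite /= -(closed_word_map f).
Qed.

Lemma rep_mul_wf (X Y : linkrep) : wf_link (prelink_mul X Y).
Proof. by rewrite wf_mul !rep_wf. Qed.

Definition rep_mul (X Y : linkrep) : linkrep := LinkRep (rep_mul_wf X Y).
Definition rep_one : linkrep := @LinkRep ([::], [::]) isT.

Definition link_mul (x y : link) : link := \pi_link (rep_mul (repr x) (repr y)).
Definition link_one : link := \pi_link rep_one.

Lemma pi_mul (X Y : linkrep) :
  link_mul (\pi X) (\pi Y) = \pi_link (rep_mul X Y).
Proof.
apply/eqP/same_linkP => /=.
apply: (@same_trans _ (prelink_mul X (repr (\pi_link Y)))).
  by apply: prelink_mul_congl; apply/same_linkP; rewrite reprK.
by apply: prelink_mul_congr; apply/same_linkP; rewrite reprK.
Qed.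

Lemma link_mulA : associative link_mul.
Proof.
move=> x y z; rewrite -[x]reprK -[y]reprK -[z]reprK !pi_mul.
by congr (\pi_link _); apply: val_inj; exact: prelink_mulA.
Qed.

Lemma link_mul1x : left_id link_one link_mul.
Proof.
move=> x; rewrite -[x]reprK pi_mul; congr (\pi_link _); apply: val_inj => /=.
case: (repr x : prelink) => ws vs; rewrite /prelink_mul /height_bound /= big_nil.
congr pair; rewrite -[RHS]map_id; apply: eq_map => w.
by rewrite -[RHS]map_id; apply: eq_map => -[a h] /=; rewrite addn0.
Qed.

Lemma link_mulx1 : right_id link_one link_mul.
Proof.
move=> x; rewrite -[x]reprK pi_mul; congr (\pi_link _); apply: val_inj => /=.
by case: (repr x : prelink) => ws vs; rewrite /prelink_mul /= !cats0.
Qed.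

Lemma same_link_size X Y : same_link X Y ->
  size X.1 = size Y.1 /\ size X.2 = size Y.2.
Proof.
elim=> {X Y} [//|X Y _ [-> ->]//|X Y Z _ [-> ->] _ [-> ->]//|||].
- by move=> *; rewrite /= !size_cat.
- by move=> ? ? ? ? /perm_size /= -> /perm_size ->.
- by move=> f X _ /=; rewrite size_map.
Qed.

Lemma link_eq1 (X : linkrep) : \pi_link X = link_one -> rep_val X = ([::], [::]).
Proof.
move/eqP/same_linkP/same_link_size => /= -[].
by case: (rep_val X) => [[|? ?] [|? ?]].
Qed.

Lemma link_unitm x y : link_mul x y = link_one -> x = link_one /\ y = link_one.
Proof.
rewrite -[x]reprK -[y]reprK pi_mul => /link_eq1 /=.
case: (repr x) (repr y) => [[[|? ?] [|? ?]] ?] [[[|? ?] [|? ?]] ?] //= _.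
by split; congr (\pi_link _); apply: val_inj.
Qed.

HB.instance Definition _ := Choice_isMonomialDef.Build link
  link_mulA link_mul1x link_mulx1 link_unitm.

End Links.

Arguments heights {I Q} X.
Arguments wf_link {I Q} X.

Section LinkAlgebra.
Variables (K : comNzRingType) (I : choiceType) (Q : quiver I).

(* As the links form a monoid, the free module on them is a monoid algebra;
   'X : {poly K} is the formal parameter h. *)
Local Notation Atilde := {malg {poly K}[link Q]}.

Lemma Atilde_scaler (c : {poly K}) (x : Atilde) : c *: x = x * c%:MP.
Proof.
rewrite -mul_malgC [LHS]fgmulUg [RHS]fgmulgU.
by apply: eq_bigr => k _; rewrite mulrC mul1m mulm1.
Qed.

Lemma Atilde_scaleAr (c : {poly K}) (x y : Atilde) : c *: (x * y) = x * (c *: y).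
Proof. by rewrite !Atilde_scaler mulrA. Qed.

(* Expressions that are not links are sent to 0: see wf_join and wf_split. *)
Definition lk (X : prelink Q) : Atilde :=
  if insub X is Some Y then << \pi_(link Q) (Y : linkrep Q) >> else 0.

(* Adds the component v w: the word w if it is nonempty, else the vertex v. *)
Definition add_word (v : I) (w : seq (dedge Q * nat)) (X : prelink Q) :
    prelink Q :=
  if w is [::] then (X.1, v :: X.2) else (w :: X.1, X.2).

Definition consecutive (h h' : nat) (X : prelink Q) : bool :=
  (h < h')%N && all (fun k => ~~ ((h < k)%N && (k < h')%N)) (heights X).

(* Since words are taken up to rotation and components are unordered, the two
   letters (a, h) and (b, h') that are exchanged may be written at the
   beginning of their components (resp. the lower one at the beginning of the
   common component). *)
Inductive relation : prelink Q -> prelink Q -> prelink Q -> {poly K} -> Prop :=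
| relation_join a h b h' u w ws vs :
    let X := (((a, h) :: u) :: ((b, h') :: w) :: ws, vs) in
    let X' := (((a, h') :: u) :: ((b, h) :: w) :: ws, vs) in
    let X'' := add_word (dtgt a) (u ++ w) (ws, vs) in
    wf_link X -> consecutive h h' X ->
    relation X X' X'' (bracket _ a b)
| relation_split a h b h' u w ws vs :
    let X := (((a, h) :: u ++ (b, h') :: w) :: ws, vs) in
    let X' := (((a, h') :: u ++ (b, h) :: w) :: ws, vs) in
    let X'' := add_word (dtgt b) w (add_word (dtgt a) u (ws, vs)) in
    wf_link X -> consecutive h h' X ->
    relation X X' X'' (bracket _ a b * 'X).

Inductive Btilde : Atilde -> Prop :=
| B_relation X X' X'' c :
    relation X X' X'' c -> Btilde (lk X - lk X' - c *: lk X'')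
| B_zero : Btilde 0
| B_add x y : Btilde x -> Btilde y -> Btilde (x + y)
| B_scale (c : {poly K}) x : Btilde x -> Btilde (c *: x).

Lemma bracket_neq0 (a b : dedge Q) : bracket {poly K} a b != 0 ->
  dtgt a = dsrc b /\ dtgt b = dsrc a.
Proof.
case: a b => [e|e] [f|f] /=; rewrite ?eqxx // ?oppr_eq0.
  by have [->|_] := eqVneq e f; rewrite ?eqxx.
by have [->|_] := eqVneq f e; rewrite ?eqxx.
Qed.

Local Notation lnk := (fun x y : dedge Q * nat => dtgt x.1 == dsrc y.1).

Lemma cycle_cons_dtgt x u y v :
  cycle lnk (x :: u ++ y :: v) =
  [&& path lnk x (rcons u y) & path lnk y (rcons v x)].
Proof. by rewrite /= rcons_cat rcons_cons -cat_rcons cat_path last_rcons. Qed.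

Lemma path_dtgt x u y z : dtgt z.1 = dtgt x.1 ->
  path lnk x (rcons u y) = path lnk z (rcons u y).
Proof. by case: u => [|t u] /= ->. Qed.

Lemma path_cycle v x y : dtgt x.1 = dsrc y.1 ->
  path lnk x (rcons v y) -> (v == [::]) || cycle lnk v.
Proof.
case: v => [//|t v] e /=; rewrite !rcons_path => /and3P[et -> el] /=.
by rewrite (eqP el) -e.
Qed.

Lemma wf_add_word v w X : (w == [::]) || cycle lnk w ->
  uniq (map snd w ++ heights X) -> wf_link X -> wf_link (add_word v w X).
Proof.
case: w => [//|t w] /= cw uw /andP[cX uX]; rewrite /wf_link /= cX.
by rewrite /heights /= map_cat /closed_word /= cw; exact: uw.
Qed.

Lemma wf_join a h b h' u w ws vs : bracket {poly K} a b != 0 ->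
  wf_link (((a, h) :: u) :: ((b, h') :: w) :: ws, vs) ->
  wf_link (add_word (dtgt a) (u ++ w) (ws, vs)).
Proof.
move=> /bracket_neq0[tab tba] /andP[/= /and3P[ca cb cs]].
rewrite /heights /= map_cat /= => /andP[_].
rewrite map_cat cat_uniq /= negb_or => /and3P[uu /andP[_ hu] /andP[_ uw]].
apply: wf_add_word; last 1 first.
- rewrite /wf_link cs; move: uw; rewrite cat_uniq => /and3P[_ _ uw].
  exact: uw.
- apply: (@path_cycle _ (a, h) (b, h')) => //.
  move: ca cb; rewrite /closed_word /= !rcons_path => /andP[pu el] pb.
  rewrite cat_path last_cat pu -andbA -rcons_path -(@path_dtgt (b, h')) ?rcons_path //.
  by rewrite (eqP el) tba.
- by rewrite map_cat -catA cat_uniq uu hu; exact: uw.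
Qed.

Lemma wf_split a h b h' u w ws vs : bracket {poly K} a b != 0 ->
  wf_link (((a, h) :: u ++ (b, h') :: w) :: ws, vs) ->
  wf_link (add_word (dtgt b) w (add_word (dtgt a) u (ws, vs))).
Proof.
move=> /bracket_neq0[tab tba] /andP[/= /andP[ca cs]].
rewrite /heights /= map_cat map_cat /= => /andP[_].
rewrite -catA cat_uniq /= negb_or => /and3P[uu /andP[_ hu] /andP[_ uw]].
have /andP[pu pw] : path lnk (a, h) (rcons u (b, h')) &&
    path lnk (b, h') (rcons w (a, h)).
  by rewrite -cycle_cons_dtgt; case/andP: ca.
have wfu : wf_link (add_word (dtgt a) u (ws, vs)).
  apply: wf_add_word; first by apply: path_cycle pu.
    rewrite cat_uniq uu; move: hu uw; rewrite has_cat negb_or => /andP[_ ->].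
    by rewrite cat_uniq => /and3P[].
  by rewrite /wf_link cs; move: uw; rewrite cat_uniq => /and3P[].
apply: wf_add_word => //; first by apply: path_cycle pw.
suff pe : perm_eq (heights (add_word (dtgt a) u (ws, vs)))
    (map snd u ++ heights (ws, vs)).
  rewrite (perm_uniq (_ : perm_eq _ (map snd u ++ (map snd w ++ heights (ws, vs))))).
    by rewrite cat_uniq uu hu.
  by rewrite perm_sym perm_catCA perm_cat2l perm_sym.
by case: (u) => [|t v]; rewrite /heights /= ?map_cat.
Qed.

Definition Bideal : {pred Atilde} := fun x => `[< Btilde x >].

Lemma BidealP x : reflect (Btilde x) (x \in Bideal).
Proof. exact: asboolP. Qed.

Lemma Bideal_zmod : zmod_closed Bideal.
Proof.
split; first by apply/BidealP; exact: B_zero.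
move=> x y /BidealP Bx /BidealP By; apply/BidealP; apply: B_add => //.
by rewrite -scaleN1r; exact: B_scale.
Qed.
HB.instance Definition _ := GRing.isZmodClosed.Build Atilde Bideal Bideal_zmod.

Lemma lk_rep (X : linkrep Q) : lk X = << \pi_(link Q) X >>.
Proof. by rewrite /lk valK. Qed.

Lemma lk_wf X (wX : wf_link X) : lk X = << \pi_(link Q) (LinkRep wX) >>.
Proof. exact: (lk_rep (LinkRep wX)). Qed.

Lemma lk_nwf X : ~~ wf_link X -> lk X = 0.
Proof. by move=> nX; rewrite /lk insubF //; exact: negbTE. Qed.

Lemma lk_same X Y : same_link X Y -> lk X = lk Y.
Proof.
move=> XY; have [wX|nX] := boolP (wf_link X); last first.
  by rewrite !lk_nwf // -(same_link_wf XY).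
have wY : wf_link Y by rewrite -(same_link_wf XY).
rewrite (lk_wf wX) (lk_wf wY).
suff -> : \pi_(link Q) (LinkRep wX) = \pi_(link Q) (LinkRep wY) by [].
by apply/eqP/same_linkP.
Qed.

Lemma lk_mul X Y : lk X * lk Y = lk (prelink_mul X Y).
Proof.
have [wX|nX] := boolP (wf_link X); last first.
  by rewrite (lk_nwf nX) mul0r lk_nwf // wf_mul (negbTE nX).
have [wY|nY] := boolP (wf_link Y); last first.
  by rewrite (lk_nwf nY) mulr0 lk_nwf // wf_mul (negbTE nY) andbF.
rewrite (lk_wf wX) (lk_wf wY) [LHS]fgmulUU mulr1 [mmul _ _]pi_mul.
by rewrite -lk_rep.
Qed.

(* Adds further components and changes the heights of the given ones. *)
Definition ext (f : nat -> nat) (W X : prelink Q) : prelink Q :=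
  ((map_heights f X).1 ++ W.1, X.2 ++ W.2).

Lemma heights_ext f W X : heights (ext f W X) = map f (heights X) ++ heights W.
Proof. by rewrite -heights_map /heights /ext /= flatten_cat map_cat. Qed.

Lemma ext_add_word f W v w X :
  ext f W (add_word v w X) = add_word v (map (fun x => (x.1, f x.2)) w) (ext f W X).
Proof. by case: w. Qed.

Lemma relation_ext f W X X' X'' c : {mono f : x y / (x < y)%N} ->
  (forall k, k \in heights W -> (forall h, h \in heights X -> (k < f h)%N) \/
    (forall h, h \in heights X -> (f h < k)%N)) ->
  wf_link (ext f W X) -> relation X X' X'' c ->
  relation (ext f W X) (ext f W X') (ext f W X'') c.
Proof.
move=> fm + + r; have cons h h' Y : h \in heights Y -> h' \in heights Y ->
    (forall k, k \in heights W -> (forall h, h \in heights Y -> (k < f h)%N) \/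
      (forall h, h \in heights Y -> (f h < k)%N)) ->
    consecutive h h' Y -> consecutive (f h) (f h') (ext f W Y).
  move=> hY h'Y WY /andP[hh' /allP no]; rewrite /consecutive fm hh' heights_ext.
  rewrite andTb all_cat; apply/andP; split; apply/allP => k.
    by case/mapP => k0 k0Y ->; rewrite !fm; exact: no.
  case/WY => lt; first by rewrite (ltnNge (f h)) (ltnW (lt _ hY)).
  by rewrite (ltnNge k (f h')) (ltnW (lt _ h'Y)) andbF.
case: {X X' X'' c} r => a h b h' u w ws vs X X' X'' wX cX WX wE.
  rewrite [ext f W X'']ext_add_word map_cat.
  apply: relation_join => //; apply: cons cX => //.
    by rewrite /heights /= inE eqxx.
  by rewrite /heights /= map_cat inE mem_cat inE eqxx !orbT.
have extE x y : ext f W (((a, x) :: u ++ (b, y) :: w) :: ws, vs)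
    = (((a, f x) :: map (fun z => (z.1, f z.2)) u
                    ++ (b, f y) :: map (fun z => (z.1, f z.2)) w)
        :: (map_heights f (ws, vs)).1 ++ W.1, vs ++ W.2).
  by rewrite /ext /= map_cat.
have := cons h h' X; rewrite [ext f W X'']ext_add_word ext_add_word /X' /X !extE.
move=> cX'; apply: relation_split; first by rewrite -extE.
apply: cX' => //.
  by rewrite /heights /= inE eqxx.
by rewrite /heights /= map_cat map_cat /= inE !mem_cat inE eqxx !orbT.
Qed.

Lemma mul_ext X Y :
  same_link (prelink_mul X Y) (ext (addn^~ (height_bound X)) X Y).
Proof. by apply: same_perm; rewrite perm_catC. Qed.

Lemma ext_mul b X Y : (height_bound X <= b)%N ->
  same_link (prelink_mul X Y) (ext id (map_heights (addn^~ b) Y) X).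
Proof.
move=> Xb; pose g h := if (h < height_bound X)%N then h else (h - height_bound X + b)%N.
suff -> : ext id (map_heights (addn^~ b) Y) X = map_heights g (prelink_mul X Y).
  apply: same_heights => h h'.
  have nb k : (k + height_bound X < height_bound X)%N = false.
    by rewrite ltnNge leq_addl.
  rewrite heights_mul !mem_cat /g.
  case/orP => [hX|/mapP[k kY ->]]; case/orP => [h'X|/mapP[k' k'Y ->]].
  - by rewrite !height_boundP.
  - rewrite (height_boundP hX) nb addnK.
    have hb := leq_trans (height_boundP hX) Xb.
    by rewrite !(leq_trans _ (leq_addl _ _)) // height_boundP.
  - rewrite nb addnK (height_boundP h'X) !ltnNge.
    have hb := leq_trans (height_boundP h'X) Xb.
    by rewrite !(leq_trans (ltnW _) (leq_addl _ _)) // height_boundP.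
  - by rewrite !nb !addnK !ltn_add2r.
rewrite /ext [RHS]/map_heights /= map_cat; congr (_ ++ _, _).
  have /(congr1 fst) : map_heights id X = map_heights g X.
    by apply: eq_in_map_heights => h /height_boundP hb; rewrite /g hb.
  by [].
rewrite -map_comp; apply: eq_map => w /=; rewrite -map_comp.
by apply: eq_map => x /=; rewrite /g ltnNge leq_addl /= addnK.
Qed.

Lemma relation_wf X X' X'' c : relation X X' X'' c -> wf_link X.
Proof. by case. Qed.

Lemma lk_repr (x : link Q) : << x >> = lk (repr x).
Proof. by rewrite lk_rep reprK. Qed.

Lemma relation_mull (x : link Q) X X' X'' c : relation X X' X'' c ->
  Btilde (<< x >> * (lk X - lk X' - c *: lk X'')).
Proof.
move=> r; rewrite lk_repr; move: (repr x) => Z.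
rewrite !mulrBr -Atilde_scaleAr !lk_mul !(lk_same (mul_ext _ _)).
apply/B_relation/relation_ext => //.
- by move=> h h'; rewrite ltn_add2r.
- move=> k /height_boundP kZ; left=> h _; exact: leq_trans kZ (leq_addl _ _).
- by rewrite -(same_link_wf (mul_ext _ _)) wf_mul rep_wf (relation_wf r).
Qed.

Lemma relation_mulr (x : link Q) X X' X'' c : relation X X' X'' c ->
  Btilde ((lk X - lk X' - c *: lk X'') * << x >>).
Proof.
move=> r; rewrite lk_repr; move: (repr x) => Z.
pose b := maxn (height_bound X) (maxn (height_bound X') (height_bound X'')).
rewrite !mulrBl -scalerAl !lk_mul.
rewrite !(lk_same (@ext_mul b _ _ _)) ?leq_max ?leqnn ?orbT //.
apply/B_relation/relation_ext => //.
- move=> k; rewrite heights_map => /mapP[k0 _ ->]; right=> h /height_boundP hX.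
  by apply: leq_trans hX (leq_trans _ (leq_addl _ _)); rewrite leq_max leqnn.
- rewrite -(same_link_wf (@ext_mul b _ _ _)) ?leq_max ?leqnn //.
  by rewrite wf_mul rep_wf (relation_wf r).
Qed.

Lemma Btilde_sum (T : Type) (s : seq T) (F : T -> Atilde) :
  (forall i, Btilde (F i)) -> Btilde (\sum_(i <- s) F i).
Proof.
by move=> BF; elim/big_rec: _ => [|i x _ Bx]; [exact: B_zero|exact: B_add].
Qed.

Lemma malg_scaleU (c : {poly K}) (x : link Q) :
  << c *g x >> = c *: (<< x >> : Atilde).
Proof. by rewrite -mul_malgC [RHS]fgmulUU mulr1 mul1m. Qed.

Lemma Btilde_mull (z x : Atilde) : Btilde x -> Btilde (z * x).
Proof.
elim=> {x} [X X' X'' c r||x y _ Bx _ By|c x _ Bx].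
- rewrite {1}[z]monalgE mulr_suml; apply: Btilde_sum => k.
  by rewrite malg_scaleU -scalerAl; apply: B_scale; exact: relation_mull r.
- by rewrite mulr0; exact: B_zero.
- by rewrite mulrDr; exact: B_add.
- by rewrite -Atilde_scaleAr; exact: B_scale.
Qed.

Lemma Btilde_mulr (z x : Atilde) : Btilde x -> Btilde (x * z).
Proof.
elim=> {x} [X X' X'' c r||x y _ Bx _ By|c x _ Bx].
- rewrite {1}[z]monalgE mulr_sumr; apply: Btilde_sum => k.
  by rewrite malg_scaleU -Atilde_scaleAr; apply: B_scale; exact: relation_mulr r.
- by rewrite mul0r; exact: B_zero.
- by rewrite mulrDl; exact: B_add.
- by rewrite -scalerAl; exact: B_scale.
Qed.

Lemma lk_coef1 X : X.1 != [::] \/ X.2 != [::] -> (lk X)@_(link_one Q) = 0.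
Proof.
move=> nX; have [wX|nwX] := boolP (wf_link X); last by rewrite lk_nwf // mcoeff0.
rewrite (lk_wf wX) mcoeffU; have [/link_eq1 e|//] := eqVneq.
by move: nX; rewrite /= in e; rewrite e; case.
Qed.

Lemma Btilde_coef1 x : Btilde x -> x@_(link_one Q) = 0.
Proof.
elim=> {x} [X X' X'' c r||x y _ Bx _ By|c x _ Bx].
- suff [nX nX' nX''] : [/\ X.1 != [::] \/ X.2 != [::],
      X'.1 != [::] \/ X'.2 != [::] & X''.1 != [::] \/ X''.2 != [::]].
    by rewrite !mcoeffB mcoeffZ !lk_coef1 // mulr0 !subr0.
  case: {X X' X'' c} r => a h b h' u w ws vs X X' X'' _ _.
    by split; [left|left|rewrite /X''; case: (u ++ w); [right|left]].
  by split; [left|left|rewrite /X''; case: w @X @X' @X''; [right|left]].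
- exact: mcoeff0.
- by rewrite mcoeffD Bx By addr0.
- by rewrite mcoeffZ Bx mulr0.
Qed.

Definition linkAlg := Quotient.quot Bideal.
HB.instance Definition _ := GRing.Zmodule.on linkAlg.

Local Notation pi := (\pi_linkAlg : Atilde -> linkAlg).

Lemma linkAlg_eqP (x y : Atilde) : reflect (pi x = pi y) (x - y \in Bideal).
Proof. by rewrite Quotient.idealrBE; exact: eqP. Qed.

Lemma linkAlg_reprB (x : Atilde) : Btilde (x - repr (pi x)).
Proof. by apply/BidealP/linkAlg_eqP; rewrite reprK. Qed.

Lemma linkAlg_piD (x y : Atilde) : pi (x + y) = pi x + pi y.
Proof. by rewrite piE. Qed.

Lemma linkAlgW (P : linkAlg -> Prop) : (forall x, P (pi x)) -> forall x, P x.
Proof. by move=> Px x; move: (Px (repr x)); rewrite reprK. Qed.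

Definition linkAlg_mul (x y : linkAlg) : linkAlg := pi (repr x * repr y).
Definition linkAlg_scale (c : {poly K}) (x : linkAlg) : linkAlg :=
  pi (c *: repr x).

Lemma linkAlg_piM (x y : Atilde) : linkAlg_mul (pi x) (pi y) = pi (x * y).
Proof.
apply/esym/linkAlg_eqP/BidealP; set x' := repr _; set y' := repr _.
have -> : x * y - x' * y' = (x - x') * y + x' * (y - y').
  by rewrite mulrBl mulrBr addrA subrK.
by apply: B_add; [apply: Btilde_mulr|apply: Btilde_mull]; exact: linkAlg_reprB.
Qed.

Lemma linkAlg_piZ (c : {poly K}) (x : Atilde) :
  linkAlg_scale c (pi x) = pi (c *: x).
Proof.
apply/esym/linkAlg_eqP/BidealP; rewrite -scalerBr; apply: B_scale.
exact: linkAlg_reprB.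
Qed.

Lemma linkAlg_mulA : associative linkAlg_mul.
Proof.
by move=> x y z; elim/linkAlgW: x => x; elim/linkAlgW: y => y; elim/linkAlgW: z => z;
  rewrite !linkAlg_piM mulrA.
Qed.
Lemma linkAlg_mul1 : left_id (pi 1) linkAlg_mul.
Proof. by move=> x; elim/linkAlgW: x => x; rewrite linkAlg_piM mul1r. Qed.
Lemma linkAlg_mulr1 : right_id (pi 1) linkAlg_mul.
Proof. by move=> x; elim/linkAlgW: x => x; rewrite linkAlg_piM mulr1. Qed.
Lemma linkAlg_mulDl : left_distributive linkAlg_mul +%R.
Proof.
move=> x y z; elim/linkAlgW: x => x; elim/linkAlgW: y => y; elim/linkAlgW: z => z;
  rewrite -linkAlg_piD !linkAlg_piM.
by rewrite mulrDl linkAlg_piD.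
Qed.
Lemma linkAlg_mulDr : right_distributive linkAlg_mul +%R.
Proof.
move=> x y z; elim/linkAlgW: x => x; elim/linkAlgW: y => y; elim/linkAlgW: z => z;
  rewrite -linkAlg_piD !linkAlg_piM.
by rewrite mulrDr linkAlg_piD.
Qed.
Lemma linkAlg_1neq0 : pi 1 != 0.
Proof.
have -> : (0 : linkAlg) = pi 0 by rewrite piE.
apply/eqP => /linkAlg_eqP/BidealP/Btilde_coef1; rewrite subr0 mcoeffUU.
by apply/eqP; exact: oner_neq0.
Qed.
HB.instance Definition _ := GRing.Zmodule_isNzRing.Build linkAlg
  linkAlg_mulA linkAlg_mul1 linkAlg_mulr1 linkAlg_mulDl linkAlg_mulDr
  linkAlg_1neq0.

Lemma linkAlg_scaleA c c' x :
  linkAlg_scale c (linkAlg_scale c' x) = linkAlg_scale (c * c') x.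
Proof. by elim/linkAlgW: x => x; rewrite !linkAlg_piZ scalerA. Qed.
Lemma linkAlg_scale1 : left_id 1 linkAlg_scale.
Proof. by move=> x; elim/linkAlgW: x => x; rewrite linkAlg_piZ scale1r. Qed.
Lemma linkAlg_scaleDr : right_distributive linkAlg_scale +%R.
Proof.
move=> c x y; elim/linkAlgW: x => x; elim/linkAlgW: y => y;
  rewrite -linkAlg_piD !linkAlg_piZ.
by rewrite scalerDr linkAlg_piD.
Qed.
Lemma linkAlg_scaleDl x : {morph linkAlg_scale^~ x : c c' / c + c'}.
Proof.
by move=> c c'; elim/linkAlgW: x => x; rewrite !linkAlg_piZ scalerDl linkAlg_piD.
Qed.
HB.instance Definition _ := GRing.Zmodule_isLmodule.Build {poly K} linkAlg
  linkAlg_scaleA linkAlg_scale1 linkAlg_scaleDr linkAlg_scaleDl.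

Lemma pi_mulE (x y : Atilde) : pi x * pi y = pi (x * y).
Proof. exact: linkAlg_piM. Qed.
Lemma pi_scaleE (c : {poly K}) (x : Atilde) : c *: pi x = pi (c *: x).
Proof. exact: linkAlg_piZ. Qed.

Lemma linkAlg_scaleAl (c : {poly K}) (x y : linkAlg) : c *: (x * y) = c *: x * y.
Proof.
elim/linkAlgW: x => x; elim/linkAlgW: y => y.
by rewrite pi_mulE !pi_scaleE pi_mulE scalerAl.
Qed.
HB.instance Definition _ := GRing.Lmodule_isLalgebra.Build {poly K} linkAlg
  linkAlg_scaleAl.

Lemma linkAlg_scaleAr (c : {poly K}) (x y : linkAlg) : c *: (x * y) = x * (c *: y).
Proof.
elim/linkAlgW: x => x; elim/linkAlgW: y => y.
by rewrite pi_mulE !pi_scaleE pi_mulE Atilde_scaleAr.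
Qed.
HB.instance Definition _ := GRing.Lalgebra_isAlgebra.Build {poly K} linkAlg
  linkAlg_scaleAr.

Definition link_class (X : linkrep Q) : linkAlg := pi << \pi_(link Q) X >>.

End LinkAlgebra.

Section DiffOps.
Variables (K : comNzRingType) (I : choiceType) (Q : quiver I) (d : I -> nat).

(* (e; (p, r)) indexes the entry of M(e) with source index p and target
   index r. *)
Definition coord : choiceType :=
  {e : edge Q & ('I_(d (src e)) * 'I_(d (tgt e)))%type}.

(* The polynomial functions on the space of representations. *)
Local Notation Poly := {malg K[{cmonom coord}]}.

Definition var (x : coord) : Poly := << ucm x >>.

Definition partial (x : coord) (p : Poly) : Poly :=
  \sum_(m <- msupp p) << p@_m *+ m x *g divcm m (ucm x) >>.

Inductive diff_op : (Poly -> Poly) -> Prop :=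
| diff_var x : diff_op (fun p => var x * p)
| diff_partial x : diff_op (partial x)
| diff_id : diff_op id
| diff_comp D D' : diff_op D -> diff_op D' -> diff_op (D \o D')
| diff_add D D' : diff_op D -> diff_op D' -> diff_op (fun p => D p + D' p)
| diff_scale (c : K) D : diff_op D -> diff_op (fun p => c *: D p).

Lemma partialEw (E : {fset {cmonom coord}}) x p : (msupp p `<=` E)%fset ->
  partial x p = \sum_(m <- E) << p@_m *+ m x *g divcm m (ucm x) >>.
Proof.
move=> pE; rewrite /partial (big_fset_incl _ pE) //= => m _ /mcoeff_outdom ->.
by rewrite mul0rn monalgU0.
Qed.

Lemma partialD x (p q : Poly) : partial x (p + q) = partial x p + partial x q.
Proof.
pose E := (msupp p `|` msupp q)%fset.
have pE : (msupp p `<=` E)%fset by exact: fsubsetUl.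
have qE : (msupp q `<=` E)%fset by exact: fsubsetUr.
rewrite (partialEw _ pE) (partialEw _ qE) (partialEw _ (msuppD_le p q)).
rewrite -big_split /=; apply: eq_bigr => m _.
by rewrite mcoeffD mulrnDl monalgUD.
Qed.

Lemma partialZ x (c : K) (p : Poly) : partial x (c *: p) = c *: partial x p.
Proof.
rewrite (partialEw _ (msuppZ_le c p)) scaler_sumr; apply: eq_bigr => m _.
by rewrite mcoeffZ -mul_malgC [RHS]fgmulUU mul1m mulrnAr.
Qed.

Lemma diff_op_add D : diff_op D -> {morph D : p q / p + q}.
Proof.
elim=> {D} [x|x||D D' _ LD _ LD'|D D' _ LD _ LD'|a D _ LD] p q //=.
- by rewrite mulrDr.
- exact: partialD.
- by rewrite LD' LD.
- by rewrite LD LD' addrACA.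
- by rewrite LD scalerDr.
Qed.

Lemma diff_op_scale D : diff_op D -> forall c, {morph D : p / c *: p}.
Proof.
elim=> {D} [x|x||D D' _ LD _ LD'|D D' _ LD _ LD'|a D _ LD] c p.
- by rewrite /= scalerAr.
- exact: partialZ.
- by [].
- by rewrite /= LD' LD.
- by rewrite /= LD LD' scalerDr.
- by rewrite /= LD !scalerA mulrC.
Qed.

Definition diff_pred : {pred Poly -> Poly} := fun D => `[< diff_op D >].

Lemma diff_submod : submod_closed diff_pred.
Proof.
split.
  apply/asboolP; have -> : (0 : Poly -> Poly) = (fun p => 0 *: id p).
    by apply/funext => p; rewrite scale0r.
  exact/diff_scale/diff_id.
move=> c D D' /asboolP oD /asboolP oD'; apply/asboolP.
exact: (diff_add (diff_scale c oD) oD').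
Qed.
HB.instance Definition _ := GRing.isSubmodClosed.Build K (Poly -> Poly) diff_pred
  diff_submod.

Record Diff := DiffOp { diff_fun :> Poly -> Poly; diff_funP : diff_fun \in diff_pred }.
HB.instance Definition _ := [isSub for diff_fun].
HB.instance Definition _ := [Choice of Diff by <:].
HB.instance Definition _ := [SubChoice_isSubLmodule of Diff by <:].

Lemma Diff_ext (D D' : Diff) : D =1 D' -> D = D'.
Proof. by move=> e; apply: val_inj; apply/funext. Qed.

Lemma DiffD (D D' : Diff) p : (D + D') p = D p + D' p.
Proof. by []. Qed.
Lemma DiffZ (c : K) (D : Diff) p : (c *: D) p = c *: D p.
Proof. by []. Qed.
Lemma Diff_opP (D : Diff) : diff_op D.
Proof. exact/asboolP/diff_funP. Qed.

Definition Diff_of D (oD : diff_op D) : Diff :=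
  @DiffOp D (introT (asboolP _) oD).
Definition Diff_one : Diff := Diff_of diff_id.
Definition Diff_mul (D D' : Diff) : Diff :=
  Diff_of (diff_comp (Diff_opP D) (Diff_opP D')).

Lemma Diff_mulA : associative Diff_mul.
Proof. by move=> D D' D''; exact: Diff_ext. Qed.
Lemma Diff_mul1 : left_id Diff_one Diff_mul.
Proof. by move=> D; exact: Diff_ext. Qed.
Lemma Diff_mulr1 : right_id Diff_one Diff_mul.
Proof. by move=> D; exact: Diff_ext. Qed.
Lemma Diff_mulDl : left_distributive Diff_mul +%R.
Proof. by move=> D D' D''; exact: Diff_ext. Qed.
Lemma Diff_mulDr : right_distributive Diff_mul +%R.
Proof.
by move=> D D' D''; apply: Diff_ext => p; exact: (diff_op_add (Diff_opP D)).
Qed.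
Lemma Diff_1neq0 : Diff_one != 0.
Proof.
apply/eqP => /(congr1 (fun D : Diff => D 1)) /= /eqP.
by rewrite (oner_eq0 Poly).
Qed.
HB.instance Definition _ := GRing.Zmodule_isNzRing.Build Diff
  Diff_mulA Diff_mul1 Diff_mulr1 Diff_mulDl Diff_mulDr Diff_1neq0.

Lemma Diff_scaleAl (c : K) (D D' : Diff) : c *: (D * D') = c *: D * D'.
Proof. exact: Diff_ext. Qed.
HB.instance Definition _ := GRing.Lmodule_isLalgebra.Build K Diff Diff_scaleAl.

Lemma Diff_scaleAr (c : K) (D D' : Diff) : c *: (D * D') = D * (c *: D').
Proof. by apply: Diff_ext => p; rewrite [RHS](diff_op_scale (Diff_opP D)). Qed.
HB.instance Definition _ := GRing.Lalgebra_isAlgebra.Build K Diff Diff_scaleAr.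

Definition Diff_var (x : coord) : Diff := Diff_of (diff_var x).
Definition Diff_partial (x : coord) : Diff := Diff_of (diff_partial x).

(* [a]_{p,r} *)
Definition entry (a : dedge Q) : 'I_(d (dsrc a)) -> 'I_(d (dtgt a)) -> Diff :=
  match a with
  | inl e => fun p r => Diff_var (existT _ e (p, r))
  | inr e => fun p r => - Diff_partial (existT _ e (r, p))
  end.

End DiffOps.

Section Rho.
Variables (K : comNzRingType) (I : choiceType) (Q : quiver I) (d : I -> nat).

Section Positions.
Variable X : linkrep Q.

Definition word (i : 'I_(size (rep_val X).1)) := tnth (in_tuple (rep_val X).1) i.

(* The index pairs (i, j), both counted from 0. *)
Definition pos : finType := {i : 'I_(size (rep_val X).1) & 'I_(size (word i))}.

Definition letter (x : pos) : dedge Q * nat :=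
  tnth (in_tuple (word (tag x))) (tagged x).
Definition arrow (x : pos) : dedge Q := (letter x).1.
Definition height (x : pos) : nat := (letter x).2.

(* (i, j) + 1 = (i, j + 1), with j + 1 modulo the length of the word. *)
Definition next (x : pos) : pos := Tagged _ (ordS (tagged x)).

Lemma dsrc_next (x : pos) : dsrc (arrow (next x)) = dtgt (arrow x).
Proof.
case: x => i j; rewrite /arrow /letter /next /=.
have /andP[/allP cX _] := rep_wf X.
have /andP[_] : closed_word (word i) by apply: cX; exact: mem_tnth.
move: j; rewrite /word; case: (tnth _ i) => [[]//|x s] j /= /(pathP x) cyc.
rewrite !(tnth_nth x) /=; have := cyc j; rewrite size_rcons ltn_ord.
move=> /(_ isT) /eqP; rewrite -cats1 -cat_cons nth_cat ltn_ord => ->.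
congr (dsrc _.1); rewrite nth_cat.
have := ltn_ord j; rewrite ltnS leq_eqVlt => /orP[/eqP ->|js].
  by rewrite modnn ltnn subnn.
by rewrite js modn_small.
Qed.

(* When the heights are 1, ..., N this lists phi^{-1}(1), ..., phi^{-1}(N). *)
Definition pos_by_height : seq pos :=
  sort (fun x y => (height x <= height y)%N) (enum pos).

Definition rho_rep : Diff K Q d :=
  (\prod_(v <- (rep_val X).2) d v)%:R *
  \sum_(k : {dffun forall x : pos, 'I_(d (dsrc (arrow x)))})
    \prod_(x <- pos_by_height)
      entry K (k x) (cast_ord (congr1 d (dsrc_next x)) (k (next x))).

End Positions.
End Rho.

(* Main.v *)
From HB Require Import structures.
Require Import Defs.
From mathcomp Require Import all_boot all_order all_algebra.
From mathcomp Require Import finmap monalg zify generic_quotient.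
From mathcomp Require Import boolp reals.
From mathcomp Require Import complex.

(** The operator of a link is a state sum: the letters carry the matrix entries
    [a]_{k, k'}, the wires between cyclically consecutive letters carry the
    summation indices, and the entries are multiplied in the order of the
    heights. It depends on the wiring and on the relative order of the heights
    only, hence on the link, and it is multiplicative because the heights of the
    second factor exceed those of the first.  Exchanging two letters of
    consecutive heights changes the sum by the commutator
      [a]_{p,r} [b]_{p',r'} - [b]_{p',r'} [a]_{p,r} = [a,b] delta_{p,r'} delta_{r,p'},
    and summing out the two indices fixed by the delta factors removes both
    letters and reconnects the four loose ends, which is the link X''.  A word
    that becomes empty leaves a free index at its vertex v, hence a factor d_v. *)

Set Implicit Arguments.
Unset Strict Implicit.
Unset Printing Implicit Defensive.

Import GRing.Theory.
Local Open Scope ring_scope.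

(** * Canonical commutation relations *)

(** Indices are plain naturals, so that regrouping letters needs no transport between index types.
    Only the source indices are bounded, because these are the ones that the wires sum over. *)
Definition weyl_commutation (I : choiceType) (Q : quiver I) (d : I -> nat)
    (V : pzRingType) (E : dedge Q -> nat -> nat -> V) : Prop :=
  forall (a b : dedge Q) (p r p' r' : nat),
    (p < d (dsrc a))%N -> (p' < d (dsrc b))%N ->
    E a p r * E b p' r' - E b p' r' * E a p r
    = (bracket int a b)%:~R *+ (p == r') *+ (r == p').

(** * Multiplication and differentiation on monomials *)

Section Monomials.
Variables (K : comNzRingType) (J : choiceType).
Implicit Types (x y : J) (m : cmonom J).

Lemma mulcm_ucmC m x y :
  mulcm (ucm x) (mulcm (ucm y) m) = mulcm (ucm y) (mulcm (ucm x) m).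
Proof. by rewrite !mulcmA (mulcmC (ucm x)). Qed.

Lemma monom_partialC (c : K) m x y :
  << c *+ m y *+ (divcm m (ucm y)) x *g divcm (divcm m (ucm y)) (ucm x) >>
  = << c *+ m x *+ (divcm m (ucm x)) y *g divcm (divcm m (ucm x)) (ucm y) >>
  :> {malg K[cmonom J]}.
Proof.
have -> : divcm (divcm m (ucm y)) (ucm x) = divcm (divcm m (ucm x)) (ucm y).
  by apply/eqP/cmP => z; rewrite !divcmE subnAC.
suff -> : c *+ m y *+ (divcm m (ucm y)) x = c *+ m x *+ (divcm m (ucm x)) y by [].
rewrite !divcmE !ucmE; have [->//|_] := eqVneq x y.
by rewrite !subn0 mulrnAC.
Qed.

(** The exponent of [x] in the product of [y] and [m] is [(x == y) + m x], and the two terms are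
    those of the Leibniz rule. *)
Lemma monom_partial_var (c : K) m x y :
  << c *+ (mulcm (ucm y) m) x *g divcm (mulcm (ucm y) m) (ucm x) >>
  = << c *+ (x == y) *g m >> + << c *+ m x *g mulcm (ucm y) (divcm m (ucm x)) >>
  :> {malg K[cmonom J]}.
Proof.
rewrite mulcmE ucmE [y == x]eq_sym mulrnDr monalgUD.
have -> : << c *+ (x == y) *g divcm (mulcm (ucm y) m) (ucm x) >>
    = << c *+ (x == y) *g m >> :> {malg K[cmonom J]}.
  have [->|_] := eqVneq x y; last by rewrite mulr0n !monalgU0.
  suff -> : divcm (mulcm (ucm y) m) (ucm y) = m by [].
  by apply/eqP/cmP => z; rewrite divcmE mulcmE addKn.
(* When [m x = 0], truncated division leaves [m] unchanged and the two monomials may differ, but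
   their coefficient is zero. *)
have [mx0|mx0] := posnP (m x); first by rewrite mx0 mulr0n !monalgU0.
suff -> : divcm (mulcm (ucm y) m) (ucm x) = mulcm (ucm y) (divcm m (ucm x)) by [].
apply/eqP/cmP => z; rewrite !(divcmE, mulcmE) !ucmE addnBA //.
by have [<-|] := eqVneq x z.
Qed.
End Monomials.

(** * The Weyl relations for the entries of the arrows *)

Section Weyl.
Variables (K : comNzRingType) (I : choiceType) (Q : quiver I) (d : I -> nat).
Local Notation coord := (Defs.coord Q d).
Local Notation Poly := {malg K[{cmonom coord}]}.
Implicit Types (x y : coord) (m : cmonom coord).

Lemma partialU x (c : K) m :
  partial x << c *g m >> = << c *+ m x *g divcm m (ucm x) >>.
Proof.
rewrite (partialEw _ (@msuppU_le _ _ m c)) big_seq_fset1.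
by rewrite mcoeffUU.
Qed.

Lemma var_mulU x (c : K) m :
  var K x * << c *g m >> = << c *g mulcm (ucm x) m >>.
Proof. by rewrite /var malgM_def fgmulUU mul1r. Qed.

Lemma diff_op_eqU (D D' : Diff K Q d) :
  (forall c m, D << c *g m >> = D' << c *g m >>) -> D = D'.
Proof.
move=> DU; apply: (@Diff_ext K I Q d) => p; rewrite [p]monalgE.
have D_sum (E : Diff K Q d) (s : seq (cmonom coord)) :
    E (\sum_(k <- s) << p@_k *g k >>) = \sum_(k <- s) E << p@_k *g k >>.
  apply: (big_morph E (diff_op_add (Diff_opP E))).
  by have := diff_op_scale (Diff_opP E) 0 0; rewrite !scale0r.
by rewrite !D_sum; apply: eq_bigr => k _.
Qed.

Lemma Diff_var_comm x y :
  Diff_var K x * Diff_var K y = Diff_var K y * Diff_var K x.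
Proof.
apply: diff_op_eqU => c m.
have E a b : (Diff_var K a * Diff_var K b) << c *g m >>
    = << c *g mulcm (ucm a) (mulcm (ucm b) m) >>.
  exact: etrans (congr1 (fun p => var K a * p) (var_mulU b c m)) (var_mulU a c _).
by rewrite (E x y) (E y x) mulcm_ucmC.
Qed.

Lemma Diff_partial_comm x y :
  Diff_partial K x * Diff_partial K y = Diff_partial K y * Diff_partial K x.
Proof.
apply: diff_op_eqU => c m.
have E a b : (Diff_partial K a * Diff_partial K b) << c *g m >>
    = << c *+ m b *+ (divcm m (ucm b)) a *g divcm (divcm m (ucm b)) (ucm a) >>.
  exact: etrans (congr1 (partial a) (partialU b c m)) (partialU a _ _).
rewrite (E x y) (E y x); exact: monom_partialC.
Qed.

Lemma Diff_partial_var x y :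
  Diff_partial K x * Diff_var K y - Diff_var K y * Diff_partial K x
  = (x == y)%:R.
Proof.
apply/eqP; rewrite subr_eq; apply/eqP; apply: diff_op_eqU => c m.
transitivity (<< c *+ (x == y) *g m >> + var K y * partial x << c *g m >>); last first.
  rewrite DiffD; congr (_ + _); case: (x == y) => //.
  by rewrite mulr0n monalgU0.
have -> : (Diff_partial K x * Diff_var K y) << c *g m >> =
   << c *+ (mulcm (ucm y) m) x *g divcm (mulcm (ucm y) m) (ucm x) >>.
  exact: etrans (congr1 (partial x) (var_mulU y c m)) (partialU x _ _).
have -> : var K y * partial x << c *g m >> =
   << c *+ m x *g mulcm (ucm y) (divcm m (ucm x)) >>.
  exact: etrans (congr1 (fun p => var K y * p) (partialU x c m)) (var_mulU y _ _).
exact: monom_partial_var.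
Qed.

(** Extension of the entries by zero to all natural indices, so that one untyped state can index
    every letter. *)
Definition nentry (a : dedge Q) (p r : nat) : Diff K Q d :=
  match insub p : option 'I_(d (dsrc a)), insub r : option 'I_(d (dtgt a)) with
  | Some p', Some r' => entry K p' r'
  | _, _ => 0
  end.

Lemma nentryE (a : dedge Q) (p : 'I_(d (dsrc a))) (r : 'I_(d (dtgt a))) :
  nentry a p r = entry K p r.
Proof. by rewrite /nentry !valK. Qed.

Lemma nentry_oob (a : dedge Q) (p r : nat) : (d (dtgt a) <= r)%N -> nentry a p r = 0.
Proof.
by move=> dr; rewrite /nentry; case: insub => // ?; rewrite insubF // ltnNge dr.
Qed.

Lemma coord_eq (e f : edge Q) (p : 'I_(d (src e))) (r : 'I_(d (tgt e)))
    (p' : 'I_(d (src f))) (r' : 'I_(d (tgt f))) :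
  ((existT _ e (p, r) : coord) == existT _ f (p', r'))
  = [&& e == f, (p : nat) == p' & (r : nat) == r'].
Proof.
have [ef|ne] := eqVneq e f; last first.
  by apply/eqP => /(congr1 (@tag _ _)) /= /eqP; rewrite (negbTE ne).
by subst f; rewrite -tag_eqE /tag_eq /= eqxx tagged_asE.
Qed.

(** Two entries of the same kind commute. In the mixed cases the minus sign in the entries of [e^*]
    gives the sign of the bracket, and the transposed coordinate gives the crossed deltas. *)
Lemma entry_comm (a b : dedge Q) (p : 'I_(d (dsrc a))) (r : 'I_(d (dtgt a)))
    (p' : 'I_(d (dsrc b))) (r' : 'I_(d (dtgt b))) :
  entry K p r * entry K p' r' - entry K p' r' * entry K p r
  = (bracket int a b)%:~R *+ ((p : nat) == r') *+ ((r : nat) == p').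
Proof.
case: a b p r p' r' => [e|e] [f|f] /= p r p' r'.
- by rewrite Diff_var_comm subrr !mul0rn.
- rewrite mulrN mulNr opprK addrC Diff_partial_var eq_sym coord_eq.
  by case: (e == f); case: (_ == _); case: (_ == _).
- rewrite mulNr mulrN opprK addrC -opprB Diff_partial_var coord_eq [f == e]eq_sym.
  rewrite [(r : nat) == _]eq_sym andbC.
  by case: (e == f); case: (_ == _); case: (_ == _); rewrite ?mul0rn ?mulr0n ?oppr0.
- by rewrite !mulrN !mulNr !opprK Diff_partial_comm subrr !mul0rn.
Qed.

(** A nonzero bracket forces the arrows to be opposite; what is kept of this is the matching of
    endpoints, which compares the dimensions at the loose ends. *)
Lemma bracket0 (a b : dedge Q) :
  (dtgt a = dsrc b /\ dtgt b = dsrc a) \/ forall S : pzRingType, bracket S a b = 0.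
Proof.
case: a b => [e|e] [f|f] /=; try by right.
  by have [->|ne] := eqVneq e f; [left|right=> S; case: eqP ne].
have [->|ne] := eqVneq f e; first by left.
by right=> S; case: eqP ne => //; rewrite oppr0.
Qed.

(** An out-of-range target index kills the left side. On the right, a nonzero bracket and delta
    would equate it with a bounded source index at the same vertex. *)
Lemma nentry_comm : weyl_commutation d nentry.
Proof.
move=> a b p r p' r' pa pb.
have [ra|ra] := ltnP r (d (dtgt a)); last first.
  rewrite (nentry_oob p ra) mul0r mulr0 subrr.
  have [rp'|_] := eqVneq r p'; last by rewrite mulr0n.
  case: (bracket0 a b) => [[ab _]|->]; last by rewrite !mul0rn.
  by move: ra pb; rewrite rp' ab ltnNge => ->.
have [rb|rb] := ltnP r' (d (dtgt b)); last first.
  rewrite (nentry_oob p' rb) mul0r mulr0 subrr.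
  have [rp'|_] := eqVneq p r'; last by rewrite !mul0rn.
  case: (bracket0 a b) => [[_ ba]|->]; last by rewrite !mul0rn.
  by move: rb pa; rewrite -rp' ba ltnNge => ->.
have := entry_comm (Ordinal pa) (Ordinal ra) (Ordinal pb) (Ordinal rb).
by rewrite -!nentryE.
Qed.
End Weyl.

(** * Sums over the indices of the wires *)

Definition upd (s : nat -> nat) (h i : nat) : nat -> nat :=
  fun k => if k == h then i else s k.

Section WireSum.
Variable V : nmodType.
Implicit Types (W : seq (nat * nat)) (s : nat -> nat) (F G : (nat -> nat) -> V).

(* The sum of [F t] over the functions [t] that agree with [s] except that
   [t h < n] for every [(h, n)] in [W]. *)
Fixpoint wsum W F s : V :=
  if W is (h, n) :: W' then \sum_(i < n) wsum W' F (upd s h i) else F s.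

Lemma wsum_cat W1 W2 F s : wsum (W1 ++ W2) F s = wsum W1 (wsum W2 F) s.
Proof. by elim: W1 s => //= -[h n] W1 IH s; apply: eq_bigr. Qed.

Lemma eq_wsum W F G s : F =1 G -> wsum W F s = wsum W G s.
Proof. by move=> FG; elim: W s => //= -[h n] W IH s; apply: eq_bigr. Qed.

Lemma updC s h i h' i' : h != h' -> upd (upd s h i) h' i' = upd (upd s h' i') h i.
Proof.
move=> hh'; apply/funext => k; rewrite /upd; case: eqP => // ->.
by rewrite eq_sym (negbTE hh').
Qed.

(** Sums over different wires commute; distinctness matters because updates of one wire overwrite
    each other. *)
Lemma wsum_front W1 h n W2 F s : h \notin map fst W1 ->
  wsum (W1 ++ (h, n) :: W2) F s = wsum ((h, n) :: W1 ++ W2) F s.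
Proof.
elim: W1 s => //= -[h' n'] W1 IH s; rewrite inE negb_or => /andP[hh' hW].
rewrite exchange_big; apply: eq_bigr => j _ /=; rewrite IH //=.
by apply: eq_bigr => i _; rewrite updC // eq_sym.
Qed.

Lemma perm_wsum W W' F s : uniq (map fst W) -> perm_eq W W' ->
  wsum W F s = wsum W' F s.
Proof.
elim: W W' s => [|[h n] W IH] W' s; first by rewrite perm_sym => _ /perm_nilP ->.
move=> /= /andP[hW uW] p.
have : (h, n) \in W' by rewrite -(perm_mem p) inE eqxx.
move=> xW'; case/splitPr: xW' p => W1 W2 p.
have p' : perm_eq W (W1 ++ W2).
  by rewrite -(perm_cons (h, n)) (permPl p) perm_catC /= perm_cons perm_catC.
rewrite wsum_front /=; first by apply: eq_bigr => i _; exact: IH.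
by apply: contra hW => /mapP[x x1 ->]; apply: map_f; rewrite (perm_mem p') mem_cat x1.
Qed.

(** Only the states reached by the sum matter. Their range bounds are what the commutation relation
    and the elimination of a delta require. *)
Lemma eq_in_wsum W F G s : uniq (map fst W) ->
  (forall t, (forall h, h \notin map fst W -> t h = s h) ->
     (forall h n, (h, n) \in W -> t h < n)%N -> F t = G t) ->
  wsum W F s = wsum W G s.
Proof.
elim: W s => [|[h n] W IH] s /=; first by move=> _; apply.
move=> /andP[hW uW] FG; apply: eq_bigr => i _; apply: IH => // t ts tW.
apply: FG => [k|k m].
  by rewrite inE negb_or => /andP[kh kW]; rewrite ts // /upd (negbTE kh).
rewrite inE => /predU1P[[-> ->]|]; last exact: tW.
by rewrite ts // /upd eqxx.
Qed.

(** [A] contains every wire that the summands may read. With [f] the identity this also allows the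
    background state to be replaced. *)
Lemma wsum_relabel (A : pred nat) (f : nat -> nat) W F F' s s' :
  {in A &, injective f} -> {subset map fst W <= A} ->
  (forall x, x \in A -> x \notin map fst W -> s x = s' (f x)) ->
  (forall t t', (forall x, x \in A -> t x = t' (f x)) -> F t = F' t') ->
  wsum W F s = wsum [seq (f x.1, x.2) | x <- W] F' s'.
Proof.
move=> fA + + FF; elim: W s s' => [|[h n] W IH] s s' WA ss /=.
  by apply: FF => x xA; apply: ss.
apply: eq_bigr => i _; apply: IH => [x xW|x xA xW].
  by apply: WA; rewrite inE xW orbT.
rewrite /upd; have [->|xh] := eqVneq x h; first by rewrite eqxx.
rewrite (inj_in_eq fA) ?(negbTE xh) //; last by apply: WA; rewrite inE eqxx.
by apply: ss => //; rewrite inE negb_or xh.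
Qed.

(** Wire [c] has the same range [n], so its value is admissible for [h] and the delta keeps exactly
    that term. *)
Lemma wsum_rcons_delta W h n c F s : uniq (map fst W) -> (c, n) \in W -> c != h ->
  wsum (rcons W (h, n)) (fun t => F t *+ (t h == t c)) s
  = wsum W (fun t => F (upd t h (t c))) s.
Proof.
move=> uW cW ch; rewrite -cats1 wsum_cat; apply: eq_in_wsum => //= t _ /(_ _ _ cW) tc.
rewrite (bigD1 (Ordinal tc)) //= big1 ?addr0 => [|i /negbTE it].
  by rewrite /upd eqxx (negbTE ch) eqxx.
by rewrite /upd eqxx (negbTE ch); rewrite -val_eqE /= in it; rewrite it.
Qed.

Lemma wsum_rcons_free W h n F s : (forall t i, F (upd t h i) = F t) ->
  wsum (rcons W (h, n)) F s = wsum W F s *+ n.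
Proof.
move=> Fh; rewrite -cats1 wsum_cat.
rewrite -[RHS](_ : wsum W (fun t => F t *+ n) s = _).
  by apply: eq_wsum => t /=; rewrite (eq_bigr (fun=> F t)) // sumr_const card_ord.
elim: W s => //= -[h' n'] W IH s; rewrite -sumrMnl; exact: eq_bigr.
Qed.

Lemma wsum_dffun (P : finType) (n h : P -> nat) (G : (P -> nat) -> V) s :
  injective h ->
  \sum_(k : {dffun forall x : P, 'I_(n x)}) G (fun x => k x)
  = wsum [seq (h x, n x) | x <- enum P] (fun t => G (t \o h)) s.
Proof.
move=> hI.
(* Generalised for induction: [r] lists the positions still to be summed, and [k] is prescribed by
   [t] at all others. *)
have gen (r : seq P) t : uniq r -> (forall x, x \notin r -> t (h x) < n x)%N ->
    \sum_(k : {dffun forall x : P, 'I_(n x)} |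
        [forall x, (x \notin r) ==> (k x == t (h x) :> nat)]) G (fun x => k x)
    = wsum [seq (h x, n x) | x <- r] (fun t => G (t \o h)) t.
  elim: r t => [|y r IH] t /=.
    move=> _ tn; have {}tn x : (t (h x) < n x)%N by apply: tn.
    pose k0 : {dffun forall x : P, 'I_(n x)} := [ffun x => Ordinal (tn x)].
    rewrite (big_pred1 k0) => [|k].
      by congr G; apply/funext => x; rewrite ffunE.
    apply/forallP/eqP => [kt|-> x]; last by rewrite ffunE eqxx.
    by apply/ffunP => x; apply/val_inj/eqP; rewrite ffunE; exact: kt.
  move=> /andP[yr ur] tn.
  rewrite (partition_big (fun k : {dffun forall x : P, 'I_(n x)} => k y) xpredT) //=.
  apply: eq_bigr => i _; rewrite -IH //; last first.
    move=> x xr; rewrite /upd (inj_eq hI); have [->//|xy] := eqVneq x y.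
    by apply: tn; rewrite inE negb_or xy.
  apply: eq_bigl => k; apply/andP/forallP => [[/forallP kt /eqP ky] x|kt].
    apply/implyP => xr; rewrite /upd (inj_eq hI).
    have [->|xy] := eqVneq x y; first by rewrite ky.
    by have /implyP := kt x; apply; rewrite inE negb_or xy.
  split; last first.
    by have /implyP/(_ yr) := kt y; rewrite /upd eqxx => /eqP/val_inj/eqP.
  apply/forallP => x; apply/implyP; rewrite inE negb_or => /andP[xy xr].
  by have /implyP/(_ xr) := kt x; rewrite /upd (inj_eq hI) (negbTE xy).
rewrite -gen ?enum_uniq // => [|x]; last by rewrite mem_enum.
by apply: eq_bigl => k; apply/esym/forallP => x; rewrite mem_enum.
Qed.
End WireSum.

Lemma wsum_mull (V : pzRingType) W (F : (nat -> nat) -> V) (a : V) s :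
  wsum W (fun t => a * F t) s = a * wsum W F s.
Proof. by elim: W s => //= -[h n] W IH s; rewrite mulr_sumr; apply: eq_bigr. Qed.

Lemma wsum_mulr (V : pzRingType) W (F : (nat -> nat) -> V) (a : V) s :
  wsum W (fun t => F t * a) s = wsum W F s * a.
Proof. by elim: W s => //= -[h n] W IH s; rewrite mulr_suml; apply: eq_bigr. Qed.

Lemma wsumB (V : zmodType) W (F G : (nat -> nat) -> V) s :
  wsum W F s - wsum W G s = wsum W (fun t => F t - G t) s.
Proof. by elim: W s => //= -[h n] W IH s; rewrite -sumrB; apply: eq_bigr. Qed.

(** * The state sum of a link *)

Section Value.
Variables (I : choiceType) (Q : quiver I) (d : I -> nat).
Variables (V : pzRingType) (E : dedge Q -> nat -> nat -> V).

Local Notation hletter := (dedge Q * nat)%type.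
(* ((a, h), h'): the letter a has height h and its successor has height h'. *)
Local Notation arc := (hletter * nat)%type.
Implicit Types (u w : seq hletter) (T : seq arc) (x y : arc) (X Y : prelink Q).

Definition start u (z : nat) : nat := head z (map snd u).

(** An open word: [z] is the height to which its last letter is attached. Cutting letters out of a
    cyclic word leaves such pieces. *)
Fixpoint chain u (z : nat) : seq arc :=
  if u is x :: u' then (x, start u' z) :: chain u' z else [::].

(** The word is closed up on its own first height; the default 0 occurs only for the empty word,
    which has no arcs. *)
Definition arcs_word w : seq arc := chain w (start w 0).
Definition arcs X : seq arc := flatten (map arcs_word X.1).

Definition key x : nat := x.1.2.
Definition key_le x y : bool := (key x <= key y)%N.
(** A wire is named by the height of the letter that it enters, so its index is the source index of
    that letter. *)
Definition wires T : seq (nat * nat) := [seq (key x, d (dsrc x.1.1)) | x <- T].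
Definition mon T (t : nat -> nat) : V :=
  \prod_(x <- T) E x.1.1 (t (key x)) (t x.2).

(** For closed arcs the background state 0 is never read. *)
Definition arcs_value T (vs : seq I) : V :=
  (\prod_(v <- vs) d v)%:R * wsum (wires T) (mon (sort key_le T)) (fun=> 0%N).

Lemma wires_keys T : map fst (wires T) = map key T.
Proof. by rewrite -map_comp. Qed.

Lemma chain_fst u z : map fst (chain u z) = u.
Proof. by elim: u => //= x u ->. Qed.

Lemma chain_keys u z : map key (chain u z) = map snd u.
Proof. by rewrite -[in RHS](chain_fst u z) -map_comp. Qed.

Lemma chain_cat u w z : chain (u ++ w) z = chain u (start w z) ++ chain w z.
Proof. by elim: u => //= x u ->; congr ((_, _) :: _); case: u. Qed.

Lemma start_cat u w z : start (u ++ w) z = start u (start w z).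
Proof. by case: u. Qed.

Lemma startP u z : start u z = z \/ start u z \in map snd u.
Proof. by case: u => [|x u]; [left|right; rewrite inE eqxx]. Qed.

Lemma chain_snd u z k : k \in map snd (chain u z) -> k = z \/ k \in map snd u.
Proof.
elim: u => //= x u IH; rewrite inE => /predU1P[->|/IH[->|ku]].
- by case: (startP u z) => [->|su]; [left|right; rewrite inE su orbT].
- by left.
- by right; rewrite inE ku orbT.
Qed.

Lemma arcs_fst X : map fst (arcs X) = flatten X.1.
Proof.
rewrite /arcs map_flatten -map_comp; congr flatten.
by rewrite -[RHS]map_id; apply: eq_map => w; exact: chain_fst.
Qed.

Lemma arcs_keys X : map key (arcs X) = heights X.
Proof. by rewrite /heights -arcs_fst -map_comp. Qed.

(** No end is loose: every index that [mon T] reads is summed over. *)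
Definition closed_arcs T := {subset map snd T <= map key T}.

Lemma closed_arcs_word w : closed_arcs (arcs_word w).
Proof.
case: w => [//|x w] k; rewrite chain_keys => /chain_snd[->|//].
by rewrite inE eqxx.
Qed.

Lemma closed_arcs_cat T T' : closed_arcs T -> closed_arcs T' -> closed_arcs (T ++ T').
Proof.
by move=> cT cT' k; rewrite !map_cat !mem_cat => /orP[/cT->|/cT'->]; rewrite ?orbT.
Qed.

Lemma closed_arcsX X : closed_arcs (arcs X).
Proof.
rewrite /arcs; elim: X.1 => //= w ws IH.
by apply: closed_arcs_cat => //; exact: closed_arcs_word.
Qed.

(** Each arc records its own successor, so a rotation of the cyclic word only reorders the arcs. *)
Lemma arcs_word_catC u w : perm_eq (arcs_word (u ++ w)) (arcs_word (w ++ u)).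
Proof.
case: u => [|x u]; first by rewrite cats0.
case: w => [|y w]; first by rewrite cats0.
by rewrite /arcs_word !chain_cat perm_catC.
Qed.

Lemma key_le_total : total key_le.
Proof. by move=> x y; exact: leq_total. Qed.

Lemma key_le_trans : transitive key_le.
Proof. by move=> x y z; exact: leq_trans. Qed.

Lemma key_inj T : uniq (map key T) -> {in T &, injective key}.
Proof.
elim: T => //= z T IH /andP[zT uT] x y; rewrite !inE.
case/predU1P=> [->|xT] /predU1P[->|yT] // e; last exact: IH.
- by case/negP: zT; rewrite e map_f.
- by case/negP: zT; rewrite -e map_f.
Qed.

(** Distinct keys make the order antisymmetric on [T], so the sorted arrangement is unique. *)
Lemma sorted_perm_sort S T : sorted key_le S -> perm_eq S T -> uniq (map key T) ->
  sort key_le T = S.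
Proof.
move=> sS ST uT; rewrite -[RHS](sorted_sort key_le_trans sS); apply/esym.
apply/perm_sort_inP => //.
- by move=> x y _ _; exact: key_le_total.
- by move=> y x z _ _ _; exact: key_le_trans.
move=> x y xS yS /anti_leq; apply: (key_inj uT); by rewrite -(perm_mem ST).
Qed.

Lemma perm_sort_arcs T T' : perm_eq T T' -> uniq (map key T) ->
  sort key_le T = sort key_le T'.
Proof.
move=> TT' uT; apply: sorted_perm_sort => //; first exact: sort_sorted key_le_total _.
by rewrite perm_sym; apply: (perm_trans TT'); rewrite perm_sym perm_sort.
Qed.

Lemma perm_arcs_value T T' vs vs' : uniq (map key T) -> perm_eq T T' -> perm_eq vs vs' ->
  arcs_value T vs = arcs_value T' vs'.
Proof.
move=> uT TT' vv; rewrite /arcs_value (perm_big _ vv).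
rewrite (perm_sort_arcs TT' uT); congr (_ * _).
by apply: perm_wsum; [rewrite wires_keys|exact: perm_map].
Qed.

Lemma sort_cat T T' : uniq (map key (T ++ T')) ->
  (forall x y, x \in T -> y \in T' -> (key x < key y)%N) ->
  sort key_le (T ++ T') = sort key_le T ++ sort key_le T'.
Proof.
move=> uT lt; apply: sorted_perm_sort => //; last first.
  by apply: perm_cat; rewrite perm_sort.
rewrite (sorted_pairwise key_le_trans) pairwise_cat -!(sorted_pairwise key_le_trans).
rewrite !sort_sorted ?andbT; try exact: key_le_total.
by apply/allrelP => x y; rewrite !mem_sort => xT yT; apply/ltnW/lt.
Qed.

Lemma sort_snd (f : nat -> nat) T :
  sort key_le [seq (x.1, f x.2) | x <- T] = [seq (x.1, f x.2) | x <- sort key_le T].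
Proof. by rewrite sort_map. Qed.

Lemma eq_mon T t t' : {in map key T, t =1 t'} -> {in map snd T, t =1 t'} ->
  mon T t = mon T t'.
Proof.
move=> k1 k2; rewrite /mon !big_seq; apply: eq_bigr => x xT.
by rewrite k1 ?k2 //; apply: map_f.
Qed.

Lemma mon_cat T T' t : mon (T ++ T') t = mon T t * mon T' t.
Proof. by rewrite /mon big_cat. Qed.

Definition relabel (f : nat -> nat) x : arc := (x.1.1, f x.1.2, f x.2).

Lemma mon_relabel f T t : mon (map (relabel f) T) t = mon T (t \o f).
Proof. by rewrite /mon big_map. Qed.

(** The factors [L] are kept apart from the wires [T] because, in the exchange of two letters, the
    renamed factors are no longer sorted. *)
Lemma wsum_mon_relabel f T L s : {in map key T &, injective f} ->
  {subset map key L <= map key T} -> {subset map snd L <= map key T} ->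
  wsum (wires T) (mon L) s
  = wsum (wires (map (relabel f) T)) (mon (map (relabel f) L)) s.
Proof.
move=> fI kL sL.
have -> : wires (map (relabel f) T) = [seq (f z.1, z.2) | z <- wires T].
  by rewrite /wires -!map_comp.
apply: (@wsum_relabel _ (mem (map key T))) => //.
- by rewrite wires_keys.
- by move=> x xT; rewrite wires_keys => /negP.
move=> t t' tt'; rewrite mon_relabel; apply: eq_mon => x xL; apply: tt'.
  exact: kL.
exact: sL.
Qed.

Lemma arcs_value_relabel f T vs : closed_arcs T -> uniq (map key T) ->
  {in map key T &, {mono f : h h' / (h < h')%N}} ->
  arcs_value (map (relabel f) T) vs = arcs_value T vs.
Proof.
move=> cT uT fm.
have fI : {in map key T &, injective f}.
  move=> h h' hT h'T fh; have := fm _ _ hT h'T; have := fm _ _ h'T hT.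
  by rewrite fh ltnn; case: ltngtP.
have uT' : uniq (map key (map (relabel f) T)).
  by rewrite -map_comp (map_comp f key) map_inj_in_uniq.
have -> : arcs_value (map (relabel f) T) vs = (\prod_(v <- vs) d v)%:R *
    wsum (wires (map (relabel f) T)) (mon (map (relabel f) (sort key_le T))) (fun=> 0%N).
  rewrite /arcs_value; congr (_ * wsum _ (mon _) _); apply: sorted_perm_sort => //.
    rewrite sorted_map; have := sort_sorted key_le_total T.
    apply: (@sub_in_sorted _ (mem T)) => [x y xT yT|]; last first.
      by apply/allP => x; rewrite mem_sort.
    rewrite /key_le /= => xy; rewrite leqNgt fm -?leqNgt //; exact: map_f.
  by apply: perm_map; rewrite perm_sort.
rewrite /arcs_value -wsum_mon_relabel // => x /mapP[y].
  by rewrite mem_sort => yT ->; exact: map_f.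
by rewrite mem_sort => yT ->; apply: cT; exact: map_f.
Qed.

(** The sorted product splits at the gap between the keys of [T] and [T'], and neither factor reads
    the wires of the other. *)
Lemma arcs_value_mul T T' vs vs' : uniq (map key (T ++ T')) ->
  closed_arcs T -> closed_arcs T' ->
  (forall x y, x \in T -> y \in T' -> (key x < key y)%N) ->
  arcs_value (T ++ T') (vs ++ vs') = arcs_value T vs * arcs_value T' vs'.
Proof.
move=> u cT cT' lt; rewrite /arcs_value sort_cat // big_cat /= !mulr_natl.
rewrite mulrnAl mulrnAr -mulrnA mulnC; congr (_ *+ _).
rewrite /wires map_cat wsum_cat -!/(wires _) -wsum_mulr; apply: eq_wsum => t.
move: u; rewrite map_cat cat_uniq => /and3P[_ /hasPn disj uT'].
(* The inner sum may start from the outer state [t], since the closed arcs [T'] read only their own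
   wires. *)
have -> : wsum (wires T') (mon (sort key_le T')) (fun=> 0%N)
    = wsum (wires T') (mon (sort key_le T')) t.
  rewrite [RHS](@wsum_relabel _ (mem (map key T')) id (wires T') _
    (mon (sort key_le T')) _ (fun=> 0%N)) ?wires_keys //.
  - by congr wsum; rewrite -[LHS]map_id; apply: eq_map => -[].
  - by move=> x xT /negP.
  move=> t1 t2 t12; apply: eq_mon => x /mapP[y]; rewrite mem_sort => yT ->.
    by apply: t12; exact: map_f.
  by apply: t12; apply: cT'; exact: map_f.
(* Conversely, the factor of [T] is constant while the wires of [T'] vary. *)
rewrite -wsum_mull; apply: eq_in_wsum; rewrite wires_keys // => t' t't _.
rewrite mon_cat; congr (_ * _).
apply: eq_mon => x /mapP[y]; rewrite mem_sort => yT ->; apply: t't.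
  by apply: contraTN (map_f key yT) => /disj.
by apply: contraTN (cT _ (map_f snd yT)) => /disj.
Qed.

Lemma arcs_map_heights f X : arcs (map_heights f X) = map (relabel f) (arcs X).
Proof.
rewrite /arcs map_flatten -!map_comp; congr flatten; apply: eq_map => w /=.
have sm z u : start (map (fun x : hletter => (x.1, f x.2)) u) (f z) = f (start u z).
  by case: u.
have cm z u : chain (map (fun x : hletter => (x.1, f x.2)) u) (f z)
    = map (relabel f) (chain u z).
  by elim: u => //= x u ->; rewrite sm.
(* The empty word is treated apart because [f] need not fix the default 0. *)
by case: w => // x w; rewrite /arcs_word -cm.
Qed.

Definition link_value X : V := arcs_value (arcs X) X.2.

(** Rotations and reorderings permute the arcs, and a change of heights is an increasing
    relabelling. Well-formedness supplies the distinct heights and is invariant along the way. *)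
Lemma same_link_value X Y : same_link X Y -> wf_link X -> link_value X = link_value Y.
Proof.
elim=> {X Y} [//|X Y XY IH wY|X Y Z XY IXY _ IYZ wX|ws1 u w ws2 vs
  |ws ws' vs vs' ew ev|f X fm].
- by rewrite IH // (same_link_wf XY).
- by rewrite IXY // IYZ // -(same_link_wf XY).
- move=> /andP[_ uX]; apply: perm_arcs_value => //; first by rewrite arcs_keys.
  by rewrite /arcs !map_cat !flatten_cat /= perm_cat2l perm_cat2r arcs_word_catC.
- move=> /andP[_ uX]; apply: perm_arcs_value => //; first by rewrite arcs_keys.
  by apply/perm_flatten/perm_map.
move=> /andP[_ uX]; rewrite /link_value arcs_map_heights arcs_value_relabel //.
- exact: closed_arcsX.
- by rewrite arcs_keys.
- by rewrite arcs_keys.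
Qed.

Lemma link_value_mul X Y : wf_link X -> wf_link Y ->
  link_value (prelink_mul X Y) = link_value X * link_value Y.
Proof.
move=> wX wY; have := wf_mul X Y; rewrite wX wY => /andP[_ uXY].
have aXY : arcs (prelink_mul X Y)
    = arcs X ++ map (relabel (addn^~ (height_bound X))) (arcs Y).
  by rewrite -arcs_map_heights /arcs /prelink_mul map_cat flatten_cat.
have -> : link_value Y =
    arcs_value (map (relabel (addn^~ (height_bound X))) (arcs Y)) Y.2.
  rewrite arcs_value_relabel ?arcs_keys //; first exact: closed_arcsX.
    by case/andP: wY.
  by move=> x y _ _; rewrite ltn_add2r.
rewrite /link_value aXY arcs_value_mul -?aXY ?arcs_keys //.
- exact: closed_arcsX.
- by rewrite -arcs_map_heights; exact: closed_arcsX.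
move=> x y xX /mapP[z _ ->]; rewrite /key /=.
apply: leq_trans (leq_addl _ _); apply: height_boundP.
by rewrite -arcs_keys; exact: map_f.
Qed.

End Value.

(** * The state sum agrees with the sum over index pairs *)

Section RhoRep.
Variables (K : comNzRingType) (I : choiceType) (Q : quiver I) (d : I -> nat).

Lemma size_chain (u : seq (dedge Q * nat)) z : size (chain u z) = size u.
Proof. by rewrite -(size_map fst) chain_fst. Qed.

Lemma nth_chain x0 y0 (u : seq (dedge Q * nat)) z j : (j < size u)%N ->
  nth y0 (chain u z) j = (nth x0 u j, nth z (map snd u) j.+1).
Proof.
elim: u j => //= x u IH [|j] /=; first by rewrite /start nth0.
by rewrite ltnS => /IH ->.
Qed.

Lemma arcs_word_enum (w : seq (dedge Q * nat)) :
  arcs_word w = [seq (tnth (in_tuple w) j, (tnth (in_tuple w) (ordS j)).2)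
                | j <- enum 'I_(size w)].
Proof.
case: w => [|x w]; first by rewrite (size0nil (size_enum_ord 0)).
apply: (@eq_from_nth _ (x, 0%N)).
  by rewrite size_chain size_map size_enum_ord.
move=> j; rewrite size_chain => jw; rewrite (nth_chain x) //.
rewrite (nth_map (Ordinal jw)) ?size_enum_ord // !(tnth_nth x) /=.
rewrite nth_enum_ord //=; congr pair.
(* At the last letter [ordS] wraps around to 0, while the lookup in the chain runs past the end and
   returns its default, the first height of the word. *)
move: jw; rewrite /= ltnS leq_eqVlt => /predU1P[->|jw].
  by rewrite modnn nth_default ?size_map.
by rewrite modn_small // (nth_map x).
Qed.

Variable X : linkrep Q.

Lemma arcs_pos :
  arcs X = [seq (letter x, height (Defs.next x)) | x <- enum (pos X)].
Proof.
(* The enumeration of a dependent pair type concatenates those of its fibres, hence lists the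
   positions word by word. *)
rewrite enumT unlock /= /tag_enum -!enumT map_flatten -map_comp /arcs.
rewrite -{1}[(rep_val X).1](map_tnth_enum (in_tuple (rep_val X).1)) -map_comp.
congr flatten; apply: eq_map => i /=; rewrite arcs_word_enum -map_comp -enumT.
by [].
Qed.

Lemma height_inj : injective (@height _ _ X).
Proof.
apply/injectiveP; rewrite /injectiveb /dinjectiveb.
have /andP[_] := rep_wf X; rewrite -arcs_keys arcs_pos -map_comp.
by congr uniq; apply: eq_map.
Qed.

(** A cast does not change the value of an ordinal, so [nentry] absorbs the casts; injectivity of
    the heights turns indices on positions into states on heights. *)
Lemma rho_repE : rho_rep K d X = link_value d (nentry K d) X.
Proof.
rewrite /rho_rep /link_value /arcs_value; congr (_ * _).
pose G (f : pos X -> nat) : Diff K Q d := \prod_(x <- pos_by_height X)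
  nentry K d (arrow x) (f x) (f (Defs.next x)).
transitivity (\sum_(k : {dffun forall x : pos X, 'I_(d (dsrc (arrow x)))}) 
    G (fun x => k x)).
  by apply: eq_bigr => k _; apply: eq_bigr => x _; rewrite -nentryE.
rewrite (@wsum_dffun _ _ (fun x => d (dsrc (arrow x))) _ G (fun=> 0%N) height_inj).
rewrite /wires arcs_pos -map_comp.
apply: eq_wsum => t; rewrite /G /mon sort_map big_map.
by [].
Qed.
End RhoRep.

(** * The exchange relations *)

Section Exchange.
Variables (I : choiceType) (Q : quiver I) (d : I -> nat).
Variables (V : pzRingType) (E : dedge Q -> nat -> nat -> V).
Hypothesis E_comm : weyl_commutation d E.

Local Notation hletter := (dedge Q * nat)%type.
Local Notation arc := (hletter * nat)%type.
Local Notation sortk := (sort (@key_le _ Q)).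
Local Notation keys := (map (@key _ Q)).
Implicit Types (u w : seq hletter) (T L : seq arc) (x y : arc) (X Y : prelink Q).

Lemma mon_swap L1 L2 x y t :
  (t (key x) < d (dsrc x.1.1))%N -> (t (key y) < d (dsrc y.1.1))%N ->
  mon E (L1 ++ x :: y :: L2) t - mon E (L1 ++ y :: x :: L2) t
  = (bracket int x.1.1 y.1.1)%:~R *
    (mon E (L1 ++ L2) t *+ (t (key x) == t y.2) *+ (t x.2 == t (key y))).
Proof.
move=> xd yd; rewrite !mon_cat; set A := mon E L1 t; set B := mon E L2 t.
have monE z z' : mon E (z :: z' :: L2) t = E z.1.1 (t (key z)) (t z.2) *
   E z'.1.1 (t (key z')) (t z'.2) * B by rewrite /mon !big_cons mulrA.
rewrite !monE -mulrBr -mulrBl (E_comm _ _ xd yd).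
rewrite !(mulrnAl, mulrnAr); congr (_ *+ _ *+ _).
by rewrite !mulrzl mulrzAr.
Qed.

(** Wire surgery: a letter followed by [h] is reconnected to [c]. *)
Definition subst_snd (h c : nat) x : arc := (x.1, if x.2 == h then c else x.2).

Lemma sort_subst h c T :
  sortk (map (subst_snd h c) T) = map (subst_snd h c) (sortk T).
Proof. by rewrite sort_map. Qed.

(** Once the letter at [h] is gone, [h] is read only as a successor, so giving it the value of [c]
    amounts to reconnecting. *)
Lemma mon_upd L h c t : h \notin keys L ->
  mon E L (upd t h (t c)) = mon E (map (subst_snd h c) L) t.
Proof.
move=> hL; rewrite /mon big_map !big_seq; apply: eq_bigr => x xL.
have kh : key x != h by apply: contraNneq hL => <-; exact: map_f.
by rewrite /upd (negbTE kh) /=; case: eqP.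
Qed.

Lemma subst_chain h c u z : h \notin map snd u ->
  map (subst_snd h c) (chain u z) = chain u (if z == h then c else z).
Proof.
elim: u => //= y u IH; rewrite inE negb_or => /andP[hy hu]; rewrite IH //.
congr ((_, _) :: _); case: u hu {IH} => //= y' u; rewrite inE negb_or => /andP[hy' _].
by rewrite eq_sym (negbTE hy').
Qed.

Lemma subst_id h c T : h \notin map snd T -> map (subst_snd h c) T = T.
Proof.
move=> hT; rewrite -[RHS]map_id; apply/eq_in_map => x xT; rewrite /subst_snd.
by case: eqP => [e|_]; [case/negP: hT; rewrite -e map_f|case: x {xT}].
Qed.

(** The dimension factor left when [add_word] records a vertex instead of a word. *)
Definition vmult (v : I) w : nat := if w is [::] then d v else 1.

Lemma arcs_add_word v w Y : arcs (add_word v w Y) = arcs_word w ++ arcs Y.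
Proof. by case: w. Qed.

Lemma arcs_value_add_word T v w Y :
  arcs_value d E T (add_word v w Y).2 = arcs_value d E T Y.2 *+ vmult v w.
Proof.
case: w => //=; rewrite /arcs_value big_cons mulnC natrM -mulrA !mulr_natl.
by rewrite mulrnAC.
Qed.

Lemma wires_fst T T' : perm_eq (map fst T) (map fst T') ->
  perm_eq (wires d T) (wires d T').
Proof.
move=> p; have wE S : wires d S = [seq (z.2, d (dsrc z.1)) | z <- map fst S].
  by rewrite -map_comp.
by rewrite !wE perm_map.
Qed.

Lemma mem_wires T (x : hletter) : x \in map fst T -> (x.2, d (dsrc x.1)) \in wires d T.
Proof. by case/mapP => y yT ->; exact: (map_f (fun y : arc => _)). Qed.

(* Summing out the wire [h] that joins the end of [w] to its start makes the
   word [w] cyclic, and yields a factor [n] if [w] is empty. *)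
Lemma wsum_close W w h n T v (c : (nat -> nat) -> bool) s :
  uniq (map fst W) -> h \notin map snd w ->
  h \notin keys T -> h \notin map snd T ->
  n = d v -> (w != [::] -> (start w h, n) \in W) ->
  (forall t i, c (upd t h i) = c t) ->
  wsum (rcons W (h, n)) (fun t => mon E (sortk (chain w h ++ T)) t *+ c t
    *+ (t h == t (start w h))) s
  = wsum W (fun t => mon E (sortk (arcs_word w ++ T)) t *+ c t) s *+ vmult v w.
Proof.
move=> uW hw hT sT nv; case: w hw => [_ _|x w hw /(_ isT) sW] ch /=.
  (* For the empty word the delta compares [h] with itself, so the wire is free. *)
  rewrite -nv -(@wsum_rcons_free _ _ h) => [|t i].
    by apply: eq_wsum => t; rewrite eqxx.
  rewrite ch; congr (_ *+ _); apply: eq_mon => k /mapP[y]; rewrite mem_sort => yT ->.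
    rewrite /upd; case: eqP => // e; case/negP: hT; rewrite -e; exact: map_f.
  rewrite /upd; case: eqP => // e; case/negP: sT; rewrite -e; exact: map_f.
(* For a nonempty word the delta identifies [h] with the first height of the word, and reconnecting
   its end there closes the chain. *)
rewrite mulr1n wsum_rcons_delta //; last first.
  by apply: contraNneq hw => <-; rewrite inE eqxx.
apply: eq_wsum => t; rewrite ch; congr (_ *+ _).
rewrite mon_upd; last first.
  apply: contra hw => /mapP[y]; rewrite mem_sort -cat_cons mem_cat => /orP[yw ->|yT e].
    have := map_f (@key _ Q) yw.
    by rewrite -[(x, _) :: _]/(chain (x :: w) h) chain_keys.
  by case/negP: hT; rewrite e map_f.
rewrite -sort_subst -cat_cons map_cat -[(x, start w h) :: _]/(chain (x :: w) h).
by rewrite subst_chain // eqxx subst_id.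
Qed.

Definition swap (h h' k : nat) : nat :=
  if k == h then h' else if k == h' then h else k.

Lemma swapK h h' : involutive (swap h h').
Proof.
move=> k; rewrite /swap; have [->|kh] := eqVneq k h.
  by rewrite eqxx; case: eqP.
by have [->|kh'] := eqVneq k h'; rewrite ?eqxx // (negbTE kh) (negbTE kh').
Qed.

(** Every other key that is not below [h] exceeds [h'], so the two letters are neighbours in the
    product. *)
Lemma sort_consecutive T x y (h h' : nat) : key x = h -> key y = h' -> (h < h')%N ->
  uniq (keys (x :: y :: T)) ->
  (forall k, k \in keys T -> ~~ ((h < k)%N && (k < h')%N)) ->
  sortk (x :: y :: T) = sortk [seq z <- T | (key z < h)%N] ++ x :: y ::
                        sortk [seq z <- T | ~~ (key z < h)%N].
Proof.
move=> xh yh hh' u no.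
have p : perm_eq (x :: y :: T)
    ([seq z <- T | (key z < h)%N] ++ [:: x; y] ++ [seq z <- T | ~~ (key z < h)%N]).
  by rewrite perm_sym perm_catCA /= !perm_cons (permEl (perm_filterC _ _)).
have T2 z : z \in T -> ~~ (key z < h)%N -> (h' < key z)%N.
  move=> zT; rewrite -leqNgt => hz; have zk := map_f (@key _ Q) zT.
  move: u; rewrite /= inE negb_or xh yh => /and3P[/andP[_ hT] h'T _].
  have := no _ zk; rewrite ltn_neqAle hz andbT negb_and negbK.
  case/orP => [/eqP e|]; first by case/negP: hT; rewrite e.
  by rewrite -leqNgt leq_eqVlt => /predU1P[e|//]; case/negP: h'T; rewrite e.
rewrite (perm_sort_arcs p u).
have {}u : uniq (keys ([seq z <- T | (key z < h)%N] ++ [:: x; y] ++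
    [seq z <- T | ~~ (key z < h)%N])) by rewrite -(perm_uniq (perm_map _ p)).
rewrite sort_cat //; last first.
  move=> z z'; rewrite mem_filter => /andP[zh _]; rewrite mem_cat !inE -orbA.
  case/or3P => [/eqP->|/eqP->|].
  - by rewrite xh.
  - by rewrite yh (ltn_trans zh).
  - rewrite mem_filter => /andP[hz' zT].
    by apply: ltn_trans zh (ltn_trans hh' _); exact: T2.
congr (_ ++ _); move: u; rewrite map_cat cat_uniq => /and3P[_ _ u].
rewrite sort_cat //; last first.
  move=> z z'; rewrite !inE mem_filter => /orP[] /eqP-> /andP[hz' zT].
    by rewrite xh (ltn_trans hh') //; exact: T2.
  by rewrite yh; exact: T2.
have -> // : sortk [:: x; y] = [:: x; y].
apply: sorted_sort; first exact: key_le_trans.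
by rewrite /= /key_le xh yh (ltnW hh').
Qed.

(* Renaming the wires by the transposition of [h] and [h'] turns the second sum
   into the first one with the factors of [a] and [b], which are adjacent,
   exchanged. *)
Lemma arcs_value_exchange (a b : dedge Q) (h h' sa sb : nat) T vs :
  let f := swap h h' in
  let T' := [seq (z.1, f z.2) | z <- T] in
  (h < h')%N -> uniq (keys (((a, h), sa) :: ((b, h'), sb) :: T)) ->
  closed_arcs (((a, h), sa) :: ((b, h'), sb) :: T) ->
  (forall k, k \in keys T -> ~~ ((h < k)%N && (k < h')%N)) ->
  arcs_value d E (((a, h), sa) :: ((b, h'), sb) :: T) vs
  - arcs_value d E (((a, h'), f sa) :: ((b, h), f sb) :: T') vs
  = (bracket int a b)%:~R * ((\prod_(v <- vs) d v)%:R *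
     wsum (wires d (((a, h), sa) :: ((b, h'), sb) :: T))
      (fun t => mon E (sortk T) t *+ (t h == t sb) *+ (t sa == t h')) (fun=> 0%N)).
Proof.
move=> f T' hh' u cl no.
set x := ((a, h), sa); set y := ((b, h'), sb).
set x' := ((a, h'), f sa); set y' := ((b, h), f sb).
have ff k : f (f k) = k by exact: swapK.
have kT' : keys T' = keys T by rewrite -map_comp.
have fk k : k \in keys T -> f k = k.
  move=> kT; move: u; rewrite /= inE negb_or => /and3P[/andP[_ hT] h'T _].
  rewrite /f /swap; case: eqP => [e|_]; first by case/negP: hT; rewrite -e.
  by case: eqP => [e|//]; case/negP: h'T; rewrite -e.
(* The renaming fixes the keys of [T] and undoes the transposition in its successors. *)
have fT (p : pred arc) : (forall z, p (z.1, f z.2) = p z) ->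
    [seq relabel f z | z <- sortk [seq z <- T' | p z]] = sortk [seq z <- T | p z].
  move=> pf; rewrite filter_map sort_snd -map_comp (eq_filter (a2 := p)) //.
  rewrite -[RHS]map_id; apply/eq_in_map => z; rewrite mem_sort mem_filter.
  case/andP => _ zT; have fz : f z.1.2 = z.1.2 := fk _ (map_f (@key _ Q) zT).
  by rewrite /relabel /= ff fz; case: z {zT fz} => -[].
have fh : f h = h' by rewrite /f /swap eqxx.
have fh' : f h' = h by rewrite /f /swap eqxx; case: eqP.
have u' : uniq (keys [:: y', x' & T']).
  by move: u; rewrite /= kT' !inE !negb_or eq_sym -!andbA => /and4P[-> -> -> ->].
rewrite /arcs_value (sort_consecutive (x := x) (y := y) (h := h) (h' := h')) //.
have -> : sortk [:: x', y' & T'] = sortk [:: y', x' & T'].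
  apply: perm_sort_arcs; first by rewrite (perm_catCA [:: x'] [:: y'] T').
  by rewrite (perm_uniq (perm_map _ (permEl (perm_catCA [:: x'] [:: y'] T')))).
rewrite (sort_consecutive (x := y') (y := x') (h := h) (h' := h')) ?kT' //.
have wE : wires d (x :: y :: T) = wires d (map (relabel f) (x' :: y' :: T')).
  rewrite /wires -!map_comp /= /key /= fh fh'; congr [:: _, _ & _].
  rewrite -map_comp; apply/eq_in_map => z zT; rewrite /key /= fk //.
  exact: (map_f (@key _ Q)).
(* [L] is the sorted second product, with [b] now before [a]; renaming restores the original arcs in
   this reversed order. *)
set L := _ ++ [:: y', x' & _].
have LE : sortk [seq z <- T | (key z < h)%N] ++ y :: x ::
   sortk [seq z <- T | ~~ (key z < h)%N] = map (relabel f) L.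
  by rewrite /L map_cat !map_cons !fT // /relabel /x' /y' /= fh fh' !ff.
have -> : wsum (wires d (x' :: y' :: T')) (mon E L) (fun=> 0%N) =
   wsum (wires d (x :: y :: T)) (mon E (map (relabel f) L)) (fun=> 0%N).
  have pL : perm_eq L (x' :: y' :: T').
    rewrite /L perm_catC /= -[X in perm_eq X _]/([:: y'] ++ [:: x'] ++ _).
    rewrite perm_catCA /= !perm_cons perm_catC.
    apply: perm_trans (permEl (perm_filterC (fun z => (key z < h)%N) T')).
    by apply: perm_cat; rewrite perm_sort.
  rewrite wE; apply: wsum_mon_relabel.
  - by move=> k k' _ _; apply: (inv_inj (@swapK h h')).
  - by move=> k; rewrite (perm_mem (perm_map _ pL)).
  move=> k; rewrite (perm_mem (perm_map _ pL)).
  have -> : map snd (x' :: y' :: T') = map f (map snd (x :: y :: T)).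
    by rewrite /= -!map_comp.
  case/mapP => k0 /cl k0T ->; move: k0T; rewrite /= !inE kT'.
  case/or3P => [/eqP->|/eqP->|k0T].
  - by rewrite fh /key eqxx.
  - by rewrite fh' /key eqxx orbT.
  - by rewrite fk // k0T !orbT.
rewrite -LE -mulrBr wsumB !mulr_natl mulrnAr; congr (_ *+ _).
rewrite -wsum_mull; apply: eq_in_wsum; first by rewrite wires_keys.
move=> t _ tW; rewrite mon_swap //; last 2 first.
- by apply: tW; rewrite /wires /= inE eqxx.
- by apply: tW; rewrite /wires /= !inE eqxx orbT.
(* With the two letters removed, the pieces below and above them concatenate to the sorted [T]. *)
congr (_ * (mon _ _ _ *+ _ *+ _)).
apply/esym/sorted_perm_sort.
- rewrite (sorted_pairwise (@key_le_trans _ Q)) pairwise_cat.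
  rewrite -!(sorted_pairwise (@key_le_trans _ Q)).
  rewrite !(sort_sorted (@key_le_total _ Q)) ?andbT.
  apply/allrelP => z z'; rewrite !mem_sort !mem_filter => /andP[zh _].
  by rewrite -leqNgt => /andP[hz' _]; apply: ltnW (leq_trans zh hz').
- apply: perm_trans (permEl (perm_filterC (fun z => (key z < h)%N) T)).
  by apply: perm_cat; rewrite perm_sort.
by move: u => /= /and3P[].
Qed.

End Exchange.

(** * Joining and splitting components *)

Section Relations.
Variables (I : choiceType) (Q : quiver I) (d : I -> nat).
Variables (V : pzRingType) (E : dedge Q -> nat -> nat -> V).
Hypothesis E_comm : weyl_commutation d E.

Local Notation hletter := (dedge Q * nat)%type.
Local Notation arc := (hletter * nat)%type.
Local Notation sortk := (sort (@key_le _ Q)).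
Local Notation keys := (map (@key _ Q)).
Local Notation lnk := (fun x y : hletter => dtgt x.1 == dsrc y.1).
Implicit Types (u w : seq hletter) (T L : seq arc) (X Y : prelink Q).

Lemma swap_id h h' k : k != h -> k != h' -> swap h h' k = k.
Proof. by rewrite /swap => /negbTE-> /negbTE->. Qed.

Lemma chain_swap h h' u z : h \notin map snd u -> h' \notin map snd u ->
  [seq (y.1, swap h h' y.2) | y <- chain u z] = chain u (swap h h' z).
Proof.
elim: u => //= y u IH; rewrite !inE !negb_or => /andP[hy hu] /andP[h'y h'u].
rewrite IH //; congr ((_, _) :: _); case: u hu h'u {IH} => //= y' u.
by rewrite !inE !negb_or => /andP[hy' _] /andP[h'y' _]; rewrite swap_id // eq_sym.
Qed.

Lemma start_swap h h' u z : h \notin map snd u -> h' \notin map snd u ->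
  swap h h' (start u z) = start u (swap h h' z).
Proof.
case: u => //= y u; rewrite !inE !negb_or => /andP[hy _] /andP[h'y _].
by rewrite swap_id // eq_sym.
Qed.

Lemma arcs_swap h h' Y : h \notin heights Y -> h' \notin heights Y ->
  [seq (y.1, swap h h' y.2) | y <- arcs Y] = arcs Y.
Proof.
move=> hY h'Y; rewrite -[RHS]map_id; apply/eq_in_map => y yY.
have := closed_arcsX (map_f snd yY); rewrite arcs_keys => y2.
rewrite swap_id; first by case: y {yY y2}.
  by apply: contraNneq hY => <-.
by apply: contraNneq h'Y => <-.
Qed.

(** The deltas glue the end of [w] to the start of [u] and the end of [u] to the start of [w]: two
    open words become one cyclic word. *)
Lemma link_value_join (a b : dedge Q) h h' u w ws vs :
  let X := (((a, h) :: u) :: ((b, h') :: w) :: ws, vs) in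
  let X' := (((a, h') :: u) :: ((b, h) :: w) :: ws, vs) in
  wf_link X -> consecutive h h' X ->
  link_value d E X - link_value d E X'
  = (bracket int a b)%:~R * link_value d E (add_word (dtgt a) (u ++ w) (ws, vs)).
Proof.
move=> X X' /andP[/= /and3P[ca cb _] uX] /andP[hh' /allP no].
pose f := swap h h'; pose Y : prelink Q := (ws, vs).
pose T := chain u h ++ chain w h' ++ arcs Y.
have fh : f h = h' by rewrite /f /swap eqxx.
have fh' : f h' = h by rewrite /f /swap eqxx; case: eqP.
have pX : perm_eq (arcs X) (((a, h), start u h) :: ((b, h'), start w h') :: T).
  by rewrite /arcs /= perm_cons; exact: (permEl (perm_catCA _ [:: _] _)).
have uT : uniq (keys (((a, h), start u h) :: ((b, h'), start w h') :: T)).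
  by rewrite -(perm_uniq (perm_map _ pX)) arcs_keys.
have [/= h_neq h_T h'_T] : [/\ h != h', h \notin keys T & h' \notin keys T].
  by move: uT; rewrite /= inE negb_or -!andbA => /and4P[].
have kT : keys T = map snd u ++ map snd w ++ heights Y.
  by rewrite /T !map_cat !chain_keys arcs_keys.
have [hu hw hY] : [/\ h \notin map snd u, h \notin map snd w & h \notin heights Y].
  by move: h_T; rewrite kT !mem_cat !negb_or => /and3P[].
have [h'u h'w h'Y] :
    [/\ h' \notin map snd u, h' \notin map snd w & h' \notin heights Y].
  by move: h'_T; rewrite kT !mem_cat !negb_or => /and3P[].
pose T' := [seq (y.1, f y.2) | y <- T].
(* In [X'] the open words end at each other's old heights, which is what the transposition does to
   their last successors. *)
have T'E : T' = chain u h' ++ chain w h ++ arcs Y.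
  by rewrite /T' /T !map_cat !chain_swap // arcs_swap // -/f fh fh'.
have -> : link_value d E X' = arcs_value d E
    (((a, h'), f (start u h)) :: ((b, h), f (start w h')) :: T') vs.
  rewrite /f !start_swap // -/f fh fh' T'E; apply/esym/perm_arcs_value => //.
    rewrite -T'E; move: uT; rewrite /= -[keys T']map_comp !inE !negb_or eq_sym -!andbA.
    by case/and4P=> -> -> -> ->.
  by rewrite /arcs /= perm_cons perm_sym; exact: (permEl (perm_catCA _ [:: _] _)).
rewrite {1}/link_value (perm_arcs_value _ _ _ pX (perm_refl _)) ?arcs_keys //.
rewrite arcs_value_exchange //; last 2 first.
- move=> k; rewrite -(perm_mem (perm_map snd pX)) -(perm_mem (perm_map (@key _ Q) pX)).
  exact: closed_arcsX.
- move=> k kT'; apply: no; rewrite -arcs_keys (perm_mem (perm_map _ pX)).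
  by rewrite !inE kT' !orbT.
case: (bracket0 a b) => [[tab tba]|->]; last by rewrite !mul0r.
congr (_ * _); rewrite /link_value arcs_add_word arcs_value_add_word /arcs_value -mulrnAr.
congr (_ * _).
pose W := wires d T; set n := d (dsrc a); set n' := d (dsrc b).
have uW : uniq (map fst W) by rewrite wires_keys; move: uT => /= /and3P[].
have uWh : uniq (map fst (rcons W (h, n))).
  by rewrite map_rcons rcons_uniq uW wires_keys h_T.
have W_u y : y \in u -> (y.2, d (dsrc y.1)) \in W.
  by move=> yu; apply: mem_wires; rewrite !map_cat !chain_fst mem_cat yu.
have W_w y : y \in w -> (y.2, d (dsrc y.1)) \in W.
  by move=> yw; apply: mem_wires; rewrite !map_cat !chain_fst !mem_cat yw orbT.
(* The end of [u] and the wire [h'] have equal dimension because [a] ends where [b] starts. If [u]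
   is empty, [start u h] is [h] itself. *)
have suW : (start u h, n') \in rcons W (h, n).
  move: ca; rewrite /closed_word /= /n' -tab; case: (u) W_u => [|x u'] Wu /=.
    by rewrite andbT mem_rcons inE => /eqP ->; rewrite eqxx.
  by case/andP=> /eqP -> _; rewrite mem_rcons inE Wu ?orbT // inE eqxx.
have suh' : start u h != h'.
  by case: (startP u h) => [->//|su]; apply: contraNneq h'u => <-.
(* Wire [h'] is summed innermost, so its delta is eliminated first; this leaves the open word
   [w ++ u] ending at [h]. *)
rewrite (@perm_wsum _ _ (rcons (rcons W (h, n)) (h', n'))); last 2 first.
- by rewrite wires_keys.
- by rewrite -!cats1 -catA perm_sym perm_catC.
rewrite (eq_wsum _ _ (G := fun t =>
    (mon E (sortk T) t *+ (t h == t (start w h'))) *+ (t h' == t (start u h)))); last first.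
  by move=> t; congr (_ *+ _); rewrite eq_sym.
rewrite wsum_rcons_delta //.
rewrite (eq_wsum _ _ (G := fun t =>
    mon E (sortk (chain (w ++ u) h ++ arcs Y)) t *+ true
    *+ (t h == t (start (w ++ u) h)))); last first.
  move=> t; rewrite mulr1n mon_upd; last first.
    by rewrite (perm_mem (perm_map _ (permEl (perm_sort _ _)))).
  rewrite -sort_subst /T !map_cat !subst_chain // (negbTE h_neq) eqxx subst_id; last first.
    by apply: contra h'Y => /closed_arcsX; rewrite arcs_keys.
  have -> : upd t h' (t (start u h)) h = t h by rewrite /upd (negbTE h_neq).
  (* If [w] is empty, the other delta also refers to [h'] and must follow the reconnection to the
     start of [u]. *)
  have -> : upd t h' (t (start u h)) (start w h') = t (start (w ++ u) h).
    rewrite start_cat; case: (w) h'w => [|x w'] /=; first by rewrite /upd eqxx.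
    by rewrite inE negb_or /upd eq_sym => /andP[/negbTE-> _].
  congr (mon _ _ _ *+ _); apply: perm_sort_arcs.
    by rewrite chain_cat -catA perm_catCA.
  by rewrite !map_cat !chain_keys arcs_keys -kT; move: uT => /= /and3P[].
(* The remaining delta closes [w ++ u] along [h]. *)
rewrite (@wsum_close _ _ d _ E W (w ++ u) h n (arcs Y) (dtgt b) xpredT) //; first last.
- rewrite start_cat => wu; move: ca cb wu; rewrite /closed_word /= /n -tba.
  case: (w) W_w => [|y w'] Ww /=; last first.
    by move=> _ /andP[/eqP -> _] _; apply: Ww; rewrite inE eqxx.
  rewrite andbT; case: (u) W_u => [//|x u'] Wu /= /andP[/eqP ta _] /eqP tb _.
  by rewrite tb -tab ta; apply: Wu; rewrite inE eqxx.
- by rewrite tba.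
- by apply: contra hY => /closed_arcsX; rewrite arcs_keys.
- by rewrite arcs_keys.
- by rewrite map_cat mem_cat negb_or hw hu.
(* The choice of vertex matters only if both words are empty; then [a] is a loop and the two targets
   coincide. *)
have -> : vmult d (dtgt b) (w ++ u) = vmult d (dtgt a) (u ++ w).
  move: ca; rewrite /closed_word; case: (u) => [|x u'] /=; last by case: (w).
  by case: (w) => [|y w'] //=; rewrite andbT tba => /eqP ->.
congr (_ *+ _); rewrite (@perm_wsum _ W (wires d (arcs_word (u ++ w) ++ arcs Y))) //.
  apply: eq_wsum => t; rewrite mulr1n; congr (mon _ _ _).
  apply: perm_sort_arcs; first by rewrite perm_cat2r arcs_word_catC.
  rewrite map_cat chain_keys map_cat arcs_keys.
  rewrite (perm_uniq (_ : perm_eq _ (keys T))); first by move: uT => /= /and3P[].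
  by rewrite kT -catA perm_catCA.
by apply: wires_fst; rewrite !map_cat !chain_fst -catA perm_refl.
Qed.

(** Here [u] runs into [h'] and [w] runs into [h], and each delta glues an open word to its own
    start, so the two close separately. *)
Lemma link_value_split (a b : dedge Q) h h' u w ws vs :
  let X := (((a, h) :: u ++ (b, h') :: w) :: ws, vs) in
  let X' := (((a, h') :: u ++ (b, h) :: w) :: ws, vs) in
  wf_link X -> consecutive h h' X ->
  link_value d E X - link_value d E X'
  = (bracket int a b)%:~R *
    link_value d E (add_word (dtgt b) w (add_word (dtgt a) u (ws, vs))).
Proof.
move=> X X' /andP[/= /andP[ca _] uX] /andP[hh' /allP no].
pose f := swap h h'; pose Y : prelink Q := (ws, vs).
pose T := chain u h' ++ chain w h ++ arcs Y.
have fh : f h = h' by rewrite /f /swap eqxx.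
have fh' : f h' = h by rewrite /f /swap eqxx; case: eqP.
have arcsE c k c' k' : perm_eq (arcs (((c, k) :: u ++ (c', k') :: w) :: ws, vs))
   (((c, k), start u k') :: ((c', k'), start w k) :: chain u k' ++ chain w k ++ arcs Y).
  rewrite /arcs /= /arcs_word /= chain_cat /= start_cat /= perm_cons -catA.
  exact: (permEl (perm_catCA _ [:: _] _)).
have pX := arcsE a h b h'.
have uT : uniq (keys (((a, h), start u h') :: ((b, h'), start w h) :: T)).
  by rewrite -(perm_uniq (perm_map _ pX)) arcs_keys.
have [/= h_neq h_T h'_T] : [/\ h != h', h \notin keys T & h' \notin keys T].
  by move: uT; rewrite /= inE negb_or -!andbA => /and4P[].
have kT : keys T = map snd u ++ map snd w ++ heights Y.
  by rewrite /T !map_cat !chain_keys arcs_keys.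
have [hu hw hY] : [/\ h \notin map snd u, h \notin map snd w & h \notin heights Y].
  by move: h_T; rewrite kT !mem_cat !negb_or => /and3P[].
have [h'u h'w h'Y] :
    [/\ h' \notin map snd u, h' \notin map snd w & h' \notin heights Y].
  by move: h'_T; rewrite kT !mem_cat !negb_or => /and3P[].
pose T' := [seq (y.1, f y.2) | y <- T].
have T'E : T' = chain u h ++ chain w h' ++ arcs Y.
  by rewrite /T' /T !map_cat !chain_swap // arcs_swap // -/f fh fh'.
have -> : link_value d E X' = arcs_value d E
    (((a, h'), f (start u h')) :: ((b, h), f (start w h)) :: T') vs.
  rewrite /f !start_swap // -/f fh fh' T'E; apply/esym/perm_arcs_value => //.
    rewrite -T'E; move: uT; rewrite /= -[keys T']map_comp !inE !negb_or eq_sym -!andbA.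
    by case/and4P=> -> -> -> ->.
  by rewrite perm_sym arcsE.
rewrite {1}/link_value (perm_arcs_value _ _ _ pX (perm_refl _)) ?arcs_keys //.
rewrite arcs_value_exchange //; last 2 first.
- move=> k; rewrite -(perm_mem (perm_map snd pX)) -(perm_mem (perm_map (@key _ Q) pX)).
  exact: closed_arcsX.
- move=> k kT'; apply: no; rewrite -arcs_keys (perm_mem (perm_map _ pX)).
  by rewrite !inE kT' !orbT.
case: (bracket0 a b) => [[tab tba]|->]; last by rewrite !mul0r.
congr (_ * _); rewrite /link_value !arcs_add_word !arcs_value_add_word /arcs_value -!mulrnAr.
congr (_ * _); pose W := wires d T; set n := d (dsrc a); set n' := d (dsrc b).
have uW : uniq (map fst W) by rewrite wires_keys; move: uT => /= /and3P[].
have uWh : uniq (map fst (rcons W (h, n))).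
  by rewrite map_rcons rcons_uniq uW wires_keys h_T.
have W_u y : y \in u -> (y.2, d (dsrc y.1)) \in W.
  by move=> yu; apply: mem_wires; rewrite !map_cat !chain_fst mem_cat yu.
have W_w y : y \in w -> (y.2, d (dsrc y.1)) \in W.
  by move=> yw; apply: mem_wires; rewrite !map_cat !chain_fst !mem_cat yw orbT.
have /andP[pu pw] : path lnk (a, h) (rcons u (b, h')) &&
    path lnk (b, h') (rcons w (a, h)).
  by rewrite -cycle_cons_dtgt; case/andP: ca.
rewrite (@perm_wsum _ _ (rcons (rcons W (h, n)) (h', n'))); last 2 first.
- by rewrite wires_keys.
- by rewrite -!cats1 -catA perm_sym perm_catC.
rewrite (eq_wsum _ _ (G := fun t => mon E (sortk (chain u h' ++ (chain w h ++ arcs Y))) t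
    *+ (t h == t (start w h)) *+ (t h' == t (start u h')))); last first.
  by move=> t; congr (_ *+ _); rewrite eq_sym.
(* The delta of wire [h] does not involve [h'], so it can be carried as a constant while [h'] is
   summed out. *)
have hsw k : k = h' -> (start w h == k) = false.
  move=> ->; apply/negbTE; case: (startP w h) => [->//|sw].
  by apply: contraNneq h'w => <-.
have sndY k : k \notin heights Y -> k \notin map snd (arcs Y).
  by apply: contra => /closed_arcsX; rewrite arcs_keys.
have sndw k z (v : seq hletter) : k != z -> k \notin map snd v ->
    k \notin map snd (chain v z).
  by move=> kz kv; apply/negP => /chain_snd[/eqP|]; apply/negP.
rewrite (@wsum_close _ _ d _ E _ u h' n' _ (dtgt a) (fun t => t h == t (start w h))) //;
    first last.
- by move=> t i; rewrite /upd (negbTE h_neq) (hsw h').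
- move: pu; case: (u) W_u => [//|x u'] Wu /= /andP[/eqP ta _] _.
  by rewrite mem_rcons inE /n' -tab ta Wu ?orbT // inE eqxx.
- by rewrite tab.
- by rewrite map_cat mem_cat negb_or sndY // sndw // eq_sym.
- by rewrite map_cat mem_cat negb_or chain_keys arcs_keys h'w.
have uT2 : uniq (keys (arcs_word u ++ chain w h ++ arcs Y)).
  by rewrite !map_cat !chain_keys arcs_keys -kT; move: uT => /= /and3P[].
rewrite (eq_wsum _ _ (G := fun t => mon E (sortk (chain w h ++ (arcs_word u ++ arcs Y))) t
    *+ true *+ (t h == t (start w h)))); last first.
  move=> t; rewrite mulr1n; congr (mon _ _ _ *+ _).
  by apply: perm_sort_arcs; rewrite // perm_catCA.
rewrite (@wsum_close _ _ d _ E W w h n _ (dtgt b) xpredT) //; first last.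
- move: pw; case: (w) W_w => [//|x w'] Ww /= /andP[/eqP tb _] _.
  by rewrite /n -tba tb Ww // inE eqxx.
- by rewrite tba.
- rewrite map_cat mem_cat negb_or sndY // andbT.
  by apply: contra hu => /closed_arcs_word; rewrite chain_keys.
- by rewrite map_cat mem_cat negb_or chain_keys arcs_keys hu.
rewrite mulrnAC; congr (_ *+ _ *+ _).
have pW : perm_eq W (wires d (arcs_word w ++ arcs_word u ++ arcs Y)).
  by apply: wires_fst; rewrite !map_cat !chain_fst perm_catCA perm_refl.
by rewrite (perm_wsum _ _ uW pW); apply: eq_wsum => t; rewrite mulr1n.
Qed.
End Relations.

(** * The homomorphism *)

Section LinkMorphism.
Local Open Scope quotient_scope.
Variables (K : comNzRingType) (I : choiceType) (Q : quiver I) (d : I -> nat).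
Variables (S : algType K) (E : dedge Q -> nat -> nat -> S).
Hypothesis E_comm : weyl_commutation d E.

Local Notation Atilde := {malg {poly K}[link Q]}.
Local Notation ev := (link_value d E).

Definition class_value (k : link Q) : S := ev (repr k).

Lemma class_valueE (X : linkrep Q) : class_value (\pi_(link Q) X) = ev X.
Proof.
apply: same_link_value; last exact: rep_wf.
by apply/same_linkP; rewrite reprK.
Qed.

Lemma class_value_mmorphism : mmorphism class_value.
Proof.
split=> [k k'|].
  rewrite -[LHS]/(class_value (\pi_(link Q) (rep_mul (repr k) (repr k')))) class_valueE.
  exact: link_value_mul (rep_wf _) (rep_wf _).
rewrite -[LHS]/(class_value (\pi_(link Q) (rep_one Q))) class_valueE.
by rewrite /link_value /arcs_value /= big_nil mul1r /mon big_nil.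
Qed.
HB.instance Definition _ := monalg.isMultiplicative.Build (link Q) S class_value
  class_value_mmorphism.

Definition at_one : {poly K} -> S := in_alg S \o horner_eval 1.
HB.instance Definition _ := GRing.RMorphism.on at_one.

Lemma at_one_comm (c : {poly K}) (x : S) : GRing.comm (at_one c) x.
Proof. by rewrite /GRing.comm /at_one /= mulr_algl mulr_algr. Qed.

Definition free_rho : Atilde -> S := mmap at_one class_value.
HB.instance Definition _ := GRing.Additive.on free_rho.

(** Although [S] need not be commutative, the coefficients map to scalars, which are central; this
    makes the linear extension multiplicative. *)
Lemma free_rho_monoid_morphism : GRing.monoid_morphism free_rho.
Proof.
split; first exact: (mmap1 (f := at_one) (h := class_value)).
have mult := commr_mmap_is_multiplicative (f := at_one) (h := class_value).
by move=> x y; apply: (mult _).1 => g m m'; exact: at_one_comm.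
Qed.

Lemma free_rhoZ c x : free_rho (c *: x) = c.[1] *: free_rho x.
Proof. by rewrite /free_rho mmapZ /at_one /= mulr_algl. Qed.

Lemma free_rho_lk X : wf_link X -> free_rho (lk K X) = ev X.
Proof.
move=> wX; rewrite (lk_wf _ wX) -[ev X](class_valueE (LinkRep wX)).
have at_one1 : at_one 1 = 1 := rmorph1 at_one.
by rewrite /free_rho mmapU /= at_one1 mul1r.
Qed.

(** [lk] sends expressions that are not links to 0, so evaluation requires well-formedness.
    Closedness depends on the arrows alone, and the exchange permutes the heights; [X''] may fail to
    be a link only when its coefficient vanishes. *)
Lemma relation_wf_others (X X' X'' : prelink Q) (c : {poly K}) :
  relation X X' X'' c -> wf_link X' /\ (c != 0 -> wf_link X'').
Proof.
have cw (w w' : seq (dedge Q * nat)) : unzip1 w = unzip1 w' ->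
    closed_word w = closed_word w'.
  move=> e; have cE v : cycle (fun x y : dedge Q * nat => dtgt x.1 == dsrc y.1) v
      = cycle (fun x y : dedge Q => dtgt x == dsrc y) (unzip1 v).
    by rewrite /unzip1 cycle_map.
  by rewrite /closed_word !cE e; congr (_ && _); case: w w' e {cE} => [|? ?] [].
case=> {X X' X'' c} a h b h' u w ws vs X X' X'' wX _; split.
- have /andP[cX uX] := wX; apply/andP; split.
    move: cX => /= /and3P[ca cb ->].
    by rewrite (cw _ ((a, h) :: u)) // ca (cw _ ((b, h') :: w)) // cb.
  rewrite (perm_uniq (_ : perm_eq _ (heights X))) // /heights /= !map_cat /=.
  by apply/permP => p; rewrite /= !count_cat /=; lia.
- move=> c0; exact: wf_join c0 wX.
- have /andP[cX uX] := wX; apply/andP; split.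
    move: cX => /= /andP[ca ->]; rewrite (cw _ ((a, h) :: u ++ (b, h') :: w)) ?ca //.
    by rewrite /unzip1 /= !map_cat.
  rewrite (perm_uniq (_ : perm_eq _ (heights X))) // /heights /= !map_cat /=.
  by apply/permP => p; rewrite /= !count_cat /=; lia.
move=> c0; apply: (wf_split (K := K)) wX; apply: contraNneq c0 => ->.
by rewrite mul0r.
Qed.

Lemma bracket_horner (a b : dedge Q) :
  (bracket {poly K} a b).[1] = (bracket int a b)%:~R.
Proof.
case: a b => [e|e] [f|f] /=; rewrite ?hornerN ?horner0 //.
  by case: eqP => _; rewrite ?hornerC ?horner0.
by case: eqP => _; rewrite ?hornerC ?horner0 ?oppr0.
Qed.

(** At h = 1 the extra factor of the splitting relation disappears, so both relations become the
    exchange identities for state sums. *)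
Lemma free_rho_relation (X X' X'' : prelink Q) (c : {poly K}) : relation X X' X'' c ->
  free_rho (lk K X - lk K X' - c *: lk K X'') = 0.
Proof.
move=> r; have [wX' wX''] := relation_wf_others r.
have wX := relation_wf r.
suff vE : ev X - ev X' = c.[1] *: ev X''.
  rewrite !raddfB /= free_rhoZ (free_rho_lk wX) (free_rho_lk wX') vE.
  have [->|c0] := eqVneq c 0; first by rewrite horner0 !scale0r subrr.
  by rewrite free_rho_lk ?subrr ?wX''.
case: r wX {wX' wX''} => {X X' X'' c} a h b h' u w ws vs X X' X'' _ cX wX.
  by rewrite (link_value_join E_comm wX cX) bracket_horner scaler_int mulrzl.
rewrite (link_value_split E_comm wX cX) hornerM hornerX mulr1 bracket_horner.
by rewrite scaler_int mulrzl.
Qed.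

Lemma free_rho_Btilde x : Btilde x -> free_rho x = 0.
Proof.
elim=> {x} [X X' X'' c /free_rho_relation //||x y _ Bx _ By|c x _ Bx].
- exact: raddf0.
- by rewrite raddfD /= Bx By addr0.
- by rewrite free_rhoZ Bx scaler0.
Qed.

Definition rho (x : linkAlg K Q) : S := free_rho (repr x).

Lemma rho_pi (x : Atilde) : rho (\pi_(linkAlg K Q) x) = free_rho x.
Proof.
apply/esym/eqP; rewrite -subr_eq0; apply/eqP.
exact: etrans (esym (raddfB free_rho _ _)) (free_rho_Btilde (linkAlg_reprB x)).
Qed.

Lemma rho_additive : additive rho.
Proof.
move=> x y; rewrite -[x]reprK -[y]reprK.
have -> : \pi_(linkAlg K Q) (repr x) - \pi_(linkAlg K Q) (repr y)
    = \pi_(linkAlg K Q) (repr x - repr y) by rewrite piE.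
by rewrite !rho_pi; exact: (raddfB free_rho).
Qed.

Lemma rho_monoid_morphism : GRing.monoid_morphism rho.
Proof.
split=> [|x y]; first exact: etrans (rho_pi 1) free_rho_monoid_morphism.1.
rewrite -[x]reprK -[y]reprK pi_mulE !rho_pi; exact: free_rho_monoid_morphism.2.
Qed.

Lemma rhoZ (c : {poly K}) (x : linkAlg K Q) : rho (c *: x) = c.[1] *: rho x.
Proof. by rewrite -[x]reprK pi_scaleE !rho_pi free_rhoZ. Qed.

Lemma rho_link_class (X : linkrep Q) : rho (link_class K X) = ev X.
Proof.
by rewrite /link_class rho_pi -(free_rho_lk (rep_wf X)) lk_rep.
Qed.

(** Any entries satisfying the commutation relations in a [K]-algebra give such a morphism;
    differential operators are the case [nentry]. *)
Lemma linkAlg_morphism : exists r : {rmorphism linkAlg K Q -> S},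
  (forall (c : {poly K}) (x : linkAlg K Q), r (c *: x) = c.[1] *: r x) /\
  (forall X : linkrep Q, r (link_class K X) = ev X).
Proof.
pose ra := GRing.isZmodMorphism.Build _ _ rho rho_additive.
pose rm := GRing.isMonoidMorphism.Build _ _ rho rho_monoid_morphism.
pose r : {rmorphism linkAlg K Q -> S} := HB.pack rho ra rm.
by exists r; split; [exact: rhoZ|exact: rho_link_class].
Qed.

End LinkMorphism.

Theorem mainTheorem5 (R : realType) (I : choiceType) (Q : quiver I)
    (d : I -> nat) :
  exists rho : {rmorphism linkAlg R[i] Q -> Diff R[i] Q d},
    (forall (c : {poly R[i]}) (x : linkAlg R[i] Q),
        rho (c *: x) = c.[1] *: rho x) /\
    (forall X : linkrep Q, rho (link_class R[i] X) = rho_rep R[i] d X).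
Proof.
have [rho [rhoZ rhoX]] := linkAlg_morphism (@nentry_comm R[i] I Q d).
by exists rho; split=> // X; rewrite rho_repE.
Qed.
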